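(* Let $(f_n)$ be a sequence of Boolean functions such that each $f_n$ is $p_n$-knowable for some $p_n>\tfrac12$. If $H(f_n)\to0$, then $(f_n)$ is noise sensitive.
   Context: Let $\Omega=\{-1,1\}$ and $\Omega^\infty=\{-1,1\}^{\mathbb N}$ with the uniform product probability measure; $\omega$ denotes a uniformly random element. A Boolean function is a measurable map $f:\Omega^\infty\to\Omega$. $\omega^{(k)}$ is $\omega$ with bit $k$ flipped; $I_k(f)=\mathbb P(f(\omega^{(k)})\ne f(\omega))$, $H(f)=\sum_kI_k(f)^2$. A set $W\subseteq\mathbb N$ is a witness set for $f$ at $\omega$ if there is an event $A$ with $\mathbb P(A)=1$ such that for all $\tilde\omega\in A$: if $\tilde\omega_i=\omega_i$ for all $i\in W$ then $f(\tilde\omega)=f(\omega)$. $f$ is finitary if almost surely a finite witness set exists; then $W(f)(\omega)$ denotes the least finite witness set in the order: smaller maximum first, then smaller cardinality, then lexicographic. $f$ is $p$-knowable if it is finitary and $\mathbb E[(\max W(f))^p]<\infty$. For $\epsilon\in[0,1]$, $\omega^\epsilon$ is obtained from $\omega$ by, independently for each coordinate, with probability $\epsilon$ replacing $\omega_i$ by a fresh uniform bit. A sequence $(f_n)$ is noise sensitive if for every $\epsilon\in(0,1]$, $\mathbb E[f_n(\omega)f_n(\omega^\epsilon)]-\mathbb E[f_n(\omega)]^2\to0$. *)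

(* Defs.v *)
From Stdlib Require Import Reals Lra Lia List Sorted ClassicalEpsilon.
Open Scope R_scope.

(* ---------- Product measures on sequence spaces, built from scratch ----------
   A sequence space is  nat -> X  with per-coordinate weights  q : X -> R.
   The measure is the Caratheodory outer measure induced by the premeasure on
   basic cylinders (prefix sets): Prob q A = inf of sum of cylinder weights
   over countable cylinder covers of A.  On measurable sets (the sigma-algebra
   generated by cylinders) this is the product probability measure. *)

Fixpoint prefixOf {X : Type} (s : list X) (w : nat -> X) : Prop :=
  match s with
  | nil => True
  | x :: t => w O = x /\ prefixOf t (fun i => w (S i))
  end.

Fixpoint cylW {X : Type} (q : X -> R) (s : list X) : R :=
  match s with
  | nil => 1
  | x :: t => q x * cylW q t
  end.

Definition isCoverSum {X : Type} (q : X -> R) (A : (nat -> X) -> Prop) (v : R) : Prop :=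
  exists c : nat -> list X,
    (forall w, A w -> exists j, prefixOf (c j) w) /\
    infinite_sum (fun j => cylW q (c j)) v.

Definition isOuter {X : Type} (q : X -> R) (A : (nat -> X) -> Prop) (r : R) : Prop :=
  (forall v, isCoverSum q A v -> r <= v) /\
  (forall r', (forall v, isCoverSum q A v -> r' <= v) -> r' <= r).

Definition Prob {X : Type} (q : X -> R) (A : (nat -> X) -> Prop) : R :=
  epsilon (inhabits 0) (fun r => isOuter q A r).

Inductive meas {X : Type} : ((nat -> X) -> Prop) -> Prop :=
  | meas_cyl : forall s, meas (prefixOf s)
  | meas_compl : forall A, meas A -> meas (fun w => ~ A w)
  | meas_union : forall A : nat -> (nat -> X) -> Prop,
      (forall n, meas (A n)) -> meas (fun w => exists n, A n w)
  | meas_ext : forall A B, (forall w, A w <-> B w) -> meas A -> meas B.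

Definition pm (b : bool) : R := if b then 1 else -1.
(* product of two elements of {-1,1}: (+1 iff equal) *)
Definition pmul (a b : bool) : bool := Bool.eqb a b.

Definition qU (b : bool) : R := / 2.

Definition ExpPM {X : Type} (q : X -> R) (g : (nat -> X) -> bool) : R :=
  1 * Prob q (fun w => g w = true) + (-1) * Prob q (fun w => g w = false).

Definition BoolFun := (nat -> bool) -> bool.
Definition measurableBF (f : BoolFun) : Prop := meas (fun w => f w = true).

Definition flip (k : nat) (w : nat -> bool) : nat -> bool :=
  fun i => if Nat.eqb i k then negb (w i) else w i.

Definition Infl (f : BoolFun) (k : nat) : R := Prob qU (fun w => f (flip k w) <> f w).

Definition Hsum (f : BoolFun) (h : R) : Prop :=
  infinite_sum (fun k => (Infl f k) ^ 2) h.

Definition witness (f : BoolFun) (w : nat -> bool) (W : nat -> Prop) : Prop :=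
  exists A, meas A /\ Prob qU A = 1 /\
    forall w', A w' -> (forall i, W i -> w' i = w i) -> f w' = f w.

Definition finset (W : list nat) : Prop := Sorted lt W.
Definition maxL (W : list nat) : nat := fold_right Nat.max O W.

Fixpoint lexlt (l1 l2 : list nat) : Prop :=
  match l1, l2 with
  | nil, _ :: _ => True
  | x :: t, y :: u => (x < y)%nat \/ (x = y /\ lexlt t u)
  | _, _ => False
  end.

Definition setlt (W1 W2 : list nat) : Prop :=
  (maxL W1 < maxL W2)%nat \/
  (maxL W1 = maxL W2 /\
    ((length W1 < length W2)%nat \/ (length W1 = length W2 /\ lexlt W1 W2))).

Definition finitary (f : BoolFun) : Prop :=
  exists B, meas B /\ Prob qU B = 1 /\
    forall w, B w -> exists W, finset W /\ witness f w (fun i => In i W).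

Definition isLeastW (f : BoolFun) (w : nat -> bool) (W : list nat) : Prop :=
  finset W /\ witness f w (fun i => In i W) /\
  forall W', finset W' -> witness f w (fun i => In i W') -> W' = W \/ setlt W W'.

Definition powR (k : nat) (p : R) : R :=
  match k with O => 0 | _ => Rpower (INR k) p end.

(* p-knowable: finitary and E[(max W(f))^p] < infinity
   (expectation of the nat-valued r.v. max W(f) as sum_k k^p P(max W(f) = k)) *)
Definition knowable (p : R) (f : BoolFun) : Prop :=
  finitary f /\
  exists S, infinite_sum
    (fun k => powR k p * Prob qU (fun w => exists W, isLeastW f w W /\ maxL W = k)) S.

(* noise: triple (omega_i, fresh bit, resample indicator), resample w.p. eps *)
Definition qN (eps : R) (t : bool * bool * bool) : R :=
  let '(_, _, u) := t in / 4 * (if u then eps else 1 - eps).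

Definition omOf (t : nat -> bool * bool * bool) : nat -> bool :=
  fun i => let '(a, _, _) := t i in a.
Definition omEps (t : nat -> bool * bool * bool) : nat -> bool :=
  fun i => let '(a, b, u) := t i in if u then b else a.

Definition NoiseCorr (eps : R) (f : BoolFun) : R :=
  ExpPM (qN eps) (fun t => pmul (f (omOf t)) (f (omEps t))).

Definition noise_sensitive (fs : nat -> BoolFun) : Prop :=
  forall eps, 0 < eps <= 1 ->
    Un_cv (fun n => NoiseCorr eps (fs n) - (ExpPM qU (fs n)) ^ 2) 0.

(* Main.v *)
Require Import Defs.
From Stdlib Require Import Reals Lra Lia List ClassicalEpsilon Classical
  FunctionalExtensionality Cantor.
Import ListNotations.
Open Scope R_scope.

(** Replace [f] by its real-valued conditional expectation given the first [m] bits, [m]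
    large: it takes values between -1 and 1, is close to [f] in [L^1], and its [L^1]
    influences do not exceed those of [f].  For such a function, again written [f],
    on a finite cube, let [W_d] be the Fourier weight at level [d].  Fix a set [T] of coordinates
    and for [i] in [T] let [f_i] be the sum of [f^(S) chi_(S - i)] over [|S| = d] with
    [S] meeting [T] exactly in [i].  Then [E f_i^2 = E (f x_i f_i)].  Truncating [f_i] at
    height [sqrt (tau E f_i^2)], the bounded part contributes at most
    [sqrt (tau E f_i^2) I_i], while the tails times [x_i] are orthogonal for different [i]
    and small by hypercontractivity.  Summing over [i] and averaging over [T] gives
    [W_d <= C_d (tau H + 1 / tau)] for every [tau > 0], so every fixed level vanishes as
    [H] tends to 0, and the noise kills the high levels. *)

(** The obstacle is that the dimension of the cube is not under control. A Boolean function of [m]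
    bits at distance [d] from [f] has influences that may be off by [2 d] each, so its sum of
    squared influences carries an error of order [m d^2], while [m] depends on [d] in an unknown
    way. Hence two approximations: a first one fixes [m]; a second one, with error small compared
    with [1 / m], may use any number of further bits, which are then averaged out. This is what
    forces bounded real-valued functions instead of Boolean ones.

    The set [T] decouples the coordinates. Since [f_i] ignores all coordinates in [T], for distinct
    [i], [j] in [T] the product of [x_i f_i] and [x_j f_j] is odd in [x_i], and cutting [f_i]
    according to its own size preserves this. The price is the probability, at least [2 ^ - d], that
    a random [T] meets a given [S] of size [d] in one point.

    [Prob] is an outer measure and is handled by subadditivity; exact values come only from events
    determined by finitely many letters. *)

(** * Finite sums over lists *)

Fixpoint sumL {A : Type} (f : A -> R) (l : list A) : R :=
  match l with
  | nil => 0
  | x :: t => f x + sumL f t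
  end.

Lemma sumL_ext {A} (f g : A -> R) l :
  (forall x, In x l -> f x = g x) -> sumL f l = sumL g l.
Proof.
  induction l as [|x l IH]; simpl; intros H; [easy|].
  rewrite IH by auto. rewrite H by auto. easy.
Qed.

Lemma sumL_le {A} (f g : A -> R) l :
  (forall x, In x l -> f x <= g x) -> sumL f l <= sumL g l.
Proof.
  induction l as [|x l IH]; simpl; intros H; [lra|].
  apply Rplus_le_compat; auto.
Qed.

Lemma sumL_add {A} (f g : A -> R) l :
  sumL (fun x => f x + g x) l = sumL f l + sumL g l.
Proof. induction l; simpl; lra. Qed.

Lemma sumL_scal {A} c (f : A -> R) l : sumL (fun x => c * f x) l = c * sumL f l.
Proof. induction l; simpl; lra. Qed.

Lemma sumL_zero {A} (l : list A) : sumL (fun _ => 0) l = 0.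
Proof. induction l; simpl; lra. Qed.

Lemma sumL_app {A} (f : A -> R) l l' : sumL f (l ++ l') = sumL f l + sumL f l'.
Proof. induction l; simpl; lra. Qed.

Lemma sumL_ge0 {A} (f : A -> R) l : (forall x, In x l -> 0 <= f x) -> 0 <= sumL f l.
Proof. intros H. rewrite <- (sumL_zero l). now apply sumL_le. Qed.

Lemma sumL_map {A B} (h : A -> B) (f : B -> R) l :
  sumL f (map h l) = sumL (fun x => f (h x)) l.
Proof. induction l; simpl; lra. Qed.

Lemma sumL_swap {A B} (f : A -> B -> R) l l' :
  sumL (fun x => sumL (fun y => f x y) l') l = sumL (fun y => sumL (fun x => f x y) l) l'.
Proof.
  induction l as [|x l IH]; simpl.
  - now rewrite sumL_zero.
  - now rewrite IH, <- sumL_add.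
Qed.

Lemma sumL_term {A} (f : A -> R) l x :
  (forall y, 0 <= f y) -> In x l -> f x <= sumL f l.
Proof.
  intros Hf Hx. induction l as [|y l IH]; simpl in *; [easy|].
  pose proof (sumL_ge0 f l (fun z _ => Hf z)).
  pose proof (Hf y). destruct Hx as [->|Hx]; [lra|]. specialize (IH Hx). lra.
Qed.

Lemma sumL_incl {A} (f : A -> R) l l' :
  (forall y, 0 <= f y) -> NoDup l -> incl l l' -> sumL f l <= sumL f l'.
Proof.
  intros Hf Hl. revert l'. induction Hl as [|x l Hx Hl IH]; intros l' Hi; simpl.
  - now apply sumL_ge0.
  - destruct (in_split x l') as [l1 [l2 ->]]; [apply Hi; simpl; auto|].
    assert (H : sumL f l <= sumL f (l1 ++ l2)).
    { apply IH. intros y Hy. specialize (Hi y (or_intror Hy)).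
      apply in_app_or in Hi. apply in_or_app. destruct Hi as [Hi|[->|Hi]]; tauto. }
    rewrite !sumL_app in *. simpl. lra.
Qed.

Lemma sumL_list_prod {A B} (f : A * B -> R) l l' :
  sumL f (list_prod l l') = sumL (fun x => sumL (fun y => f (x, y)) l') l.
Proof.
  induction l as [|x l IH]; simpl; [easy|].
  now rewrite sumL_app, IH, sumL_map.
Qed.

Lemma sumL_seq_S f n : sumL f (seq 0 (S n)) = sumL f (seq 0 n) + f n.
Proof. rewrite seq_S, sumL_app. simpl. lra. Qed.

Lemma sumL_seq_sum_f_R0 f n : sumL f (seq 0 (S n)) = sum_f_R0 f n.
Proof.
  induction n as [|n IH]; [simpl; lra|].
  rewrite sumL_seq_S, IH. easy.
Qed.

Lemma sumL_seq_mono f n m :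
  (forall j, 0 <= f j) -> (n <= m)%nat -> sumL f (seq 0 n) <= sumL f (seq 0 m).
Proof.
  intros Hf Hnm. apply sumL_incl; auto using seq_NoDup.
  intros x Hx. apply in_seq in Hx. apply in_seq. lia.
Qed.

Lemma sumL_geometric (n : nat) : sumL (fun j => (1 / 2) ^ j) (seq 0 n) <= 2.
Proof.
  assert (H : sumL (fun j => (1 / 2) ^ j) (seq 0 n) = 2 - 2 * (1 / 2) ^ n).
  { induction n as [|n IH]; [simpl; lra|]. rewrite sumL_seq_S, IH. simpl. lra. }
  rewrite H. pose proof (pow_lt (1 / 2) n). lra.
Qed.

Lemma sumL_single_le {A} (l : list A) (y : A) (a : A -> R) :
  NoDup l -> 0 <= a y ->
  sumL (fun x => if excluded_middle_informative (x = y) then a x else 0) l <= a y.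
Proof.
  intros Hl Ha. induction Hl as [|x l Hx Hl IH]; simpl; [easy|].
  destruct (excluded_middle_informative (x = y)) as [->|n]; [|lra].
  rewrite (sumL_ext _ (fun _ => 0)); [rewrite sumL_zero; lra|].
  intros z Hz. destruct (excluded_middle_informative (z = y)) as [->|]; easy.
Qed.

Lemma sumL_average {A} (q a : A -> R) l v :
  (forall x, 0 <= q x) -> sumL q l = 1 -> sumL (fun x => q x * a x) l <= v ->
  exists x, In x l /\ a x <= v.
Proof.
  intros Hq H1 Hv. apply NNPP. intros Hn.
  assert (Ha : forall x, In x l -> v < a x).
  { intros x Hx. apply Rnot_le_lt. intros Hle. apply Hn. eauto. }
  assert (H : v * sumL q l <= sumL (fun x => q x * a x) l /\
    (0 < sumL q l -> v * sumL q l < sumL (fun x => q x * a x) l)).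
  { clear Hn H1 Hv. induction l as [|x l IH]; simpl; [lra|].
    destruct IH as [I1 I2]; [intros; apply Ha; simpl; auto|].
    pose proof (Hq x). pose proof (Ha x (or_introl eq_refl)).
    pose proof (sumL_ge0 q l (fun z _ => Hq z)).
    split; [nra|]. intros H3. destruct (Req_dec (q x) 0) as [H4|H4]; [|nra].
    rewrite H4 in *. assert (H5 : 0 < sumL q l) by lra. specialize (I2 H5). lra. }
  rewrite H1 in H. lra.
Qed.

Lemma le_by_eps a b c : 0 <= c -> (forall e, 0 < e -> a <= b + c * e) -> a <= b.
Proof.
  intros Hc H. apply Rnot_lt_le. intros Hlt.
  specialize (H ((a - b) / (2 * (c + 1)))).
  assert (He : 0 < (a - b) / (2 * (c + 1))) by (apply Rdiv_lt_0_compat; lra).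
  specialize (H He).
  assert ((c + 1) * ((a - b) / (2 * (c + 1))) = (a - b) / 2) by (field; lra).
  nra.
Qed.

(** * Outer measures on sequence spaces *)

(** The field [wt_small] excludes a point mass. A cover is an infinite sequence of nonempty
    cylinders, so even a finite cover must be padded; repeating a letter of weight at most 1/2 gives
    cylinders whose total weight is as small as desired. *)
Record alphabet (X : Type) := Alphabet {
  letters : list X;
  wt : X -> R;
  letters_nodup : NoDup letters;
  letters_all : forall x, In x letters;
  wt_ge0 : forall x, 0 <= wt x;
  wt_sum : sumL wt letters = 1;
  wt_small : exists x, wt x <= 1 / 2
}.
Arguments letters {X}.
Arguments wt {X}.

Lemma cylW_ge0 {X} (q : X -> R) s : (forall x, 0 <= q x) -> 0 <= cylW q s.
Proof. intros Hq. induction s; simpl; [lra|]. now apply Rmult_le_pos. Qed.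

(** Bounding all partial sums replaces the convergent series of [isCoverSum], so that covers can be
    rearranged and merged without computing limits. *)
Definition covered {X} (q : X -> R) (A : (nat -> X) -> Prop) (v : R) : Prop :=
  exists c : nat -> list X,
    (forall w, A w -> exists j, prefixOf (c j) w) /\
    forall N, sumL (fun j => cylW q (c j)) (seq 0 N) <= v.

Lemma cover_sum_covered {X} (q : X -> R) A v :
  (forall x, 0 <= q x) -> isCoverSum q A v -> covered q A v.
Proof.
  intros Hq [c [H1 H2]]. exists c. split; [easy|]. intros N.
  assert (Hc : forall j, 0 <= cylW q (c j)) by (intros; now apply cylW_ge0).
  apply Rle_trans with (sumL (fun j => cylW q (c j)) (seq 0 (S N))).
  - apply sumL_seq_mono; [easy|lia].
  - rewrite sumL_seq_sum_f_R0. now apply sum_incr.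
Qed.

Lemma covered_cover_sum {X} (q : X -> R) A v :
  (forall x, 0 <= q x) -> covered q A v -> exists v', v' <= v /\ isCoverSum q A v'.
Proof.
  intros Hq [c [H1 H2]].
  assert (Hc : forall j, 0 <= cylW q (c j)) by (intros; now apply cylW_ge0).
  destruct (growing_cv (sum_f_R0 (fun j => cylW q (c j)))) as [l Hl].
  - intros n. simpl. specialize (Hc (S n)). lra.
  - exists v. intros x [n ->]. rewrite <- sumL_seq_sum_f_R0. easy.
  - exists l. split; [|now exists c].
    apply Rnot_lt_le. intros Hlt. destruct (Hl (l - v)) as [N HN]; [lra|].
    specialize (HN N (le_n N)). unfold Rdist in HN.
    rewrite <- sumL_seq_sum_f_R0 in HN. specialize (H2 (S N)).
    apply Rabs_def2 in HN. lra.
Qed.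

Lemma small_cover {X} (M : alphabet X) : exists x0, forall K N,
  sumL (fun j => cylW (wt M) (repeat x0 (K + j))) (seq 0 N) <= 2 * (1 / 2) ^ K.
Proof.
  destruct (wt_small X M) as [x0 Hx0]. exists x0. intros K N.
  assert (H : forall n, cylW (wt M) (repeat x0 n) <= (1 / 2) ^ n).
  { induction n as [|n IH]; simpl; [lra|].
    apply Rmult_le_compat; auto using wt_ge0, cylW_ge0. }
  apply Rle_trans with (sumL (fun j => (1 / 2) ^ K * (1 / 2) ^ j) (seq 0 N)).
  - apply sumL_le. intros j _. rewrite <- pow_add. apply H.
  - rewrite sumL_scal, Rmult_comm. apply Rmult_le_compat_r; [|apply sumL_geometric].
    apply pow_le; lra.
Qed.

(** The [epsilon] in [Prob] is meaningful because the infimum exists: cover sums are nonnegative,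
    and the words [repeat x0 j], the first of which is empty, cover everything at cost at most 2. *)
Lemma prob_outer {X} (M : alphabet X) A : isOuter (wt M) A (Prob (wt M) A).
Proof.
  unfold Prob. apply epsilon_spec.
  destruct (small_cover M) as [x0 Hx0].
  assert (Hc : covered (wt M) A 2).
  { exists (repeat x0). split; [now exists O|].
    intros N. specialize (Hx0 O N). simpl in Hx0. lra. }
  apply covered_cover_sum in Hc; [|apply wt_ge0]. destruct Hc as [v [_ Hv]].
  destruct (completeness (fun r => isCoverSum (wt M) A (- r))) as [l [L1 L2]].
  - exists 0. intros r Hr. apply cover_sum_covered in Hr; [|apply wt_ge0].
    destruct Hr as [c [_ Hr]]. specialize (Hr O). simpl in Hr. lra.
  - exists (- v). now rewrite Ropp_involutive.
  - exists (- l). split.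
    + intros u Hu. rewrite <- (Ropp_involutive u) in Hu. specialize (L1 _ Hu). lra.
    + intros r Hr. apply Ropp_le_cancel. rewrite Ropp_involutive.
      apply L2. intros u Hu. specialize (Hr _ Hu). lra.
Qed.

Lemma prob_le_covered {X} (M : alphabet X) A v :
  covered (wt M) A v -> Prob (wt M) A <= v.
Proof.
  intros H. apply covered_cover_sum in H; [|apply wt_ge0]. destruct H as [u [H1 H2]].
  apply (prob_outer M A) in H2. lra.
Qed.

Lemma prob_covered {X} (M : alphabet X) A e :
  0 < e -> covered (wt M) A (Prob (wt M) A + e).
Proof.
  intros He. apply NNPP. intros Hn.
  assert (H : Prob (wt M) A + e <= Prob (wt M) A); [|lra].
  apply (prob_outer M A). intros v Hv. apply Rnot_lt_le. intros Hlt.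
  apply Hn. apply cover_sum_covered in Hv; [|apply wt_ge0].
  destruct Hv as [c [H1 H2]]. exists c. split; [easy|].
  intros N. specialize (H2 N). lra.
Qed.

Lemma prob_ge0 {X} (M : alphabet X) A : 0 <= Prob (wt M) A.
Proof.
  apply (prob_outer M A). intros v Hv. apply cover_sum_covered in Hv; [|apply wt_ge0].
  destruct Hv as [c [_ Hc]]. apply (Hc O).
Qed.

Lemma prob_mono {X} (M : alphabet X) (A B : (nat -> X) -> Prop) :
  (forall w, A w -> B w) -> Prob (wt M) A <= Prob (wt M) B.
Proof.
  intros H. apply le_by_eps with 1; [lra|]. intros e He. rewrite Rmult_1_l.
  apply prob_le_covered. destruct (prob_covered M B e He) as [c [H1 H2]].
  exists c. split; auto.
Qed.

Lemma prob_ext {X} (M : alphabet X) (A B : (nat -> X) -> Prop) :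
  (forall w, A w <-> B w) -> Prob (wt M) A = Prob (wt M) B.
Proof. intros H. apply Rle_antisym; apply prob_mono; intros w; apply H. Qed.

Lemma prob_empty {X} (M : alphabet X) (A : (nat -> X) -> Prop) :
  (forall w, ~ A w) -> Prob (wt M) A = 0.
Proof.
  intros HA. apply Rle_antisym; [|apply prob_ge0].
  apply le_by_eps with 1; [lra|]. intros e He.
  destruct (small_cover M) as [x0 Hx0].
  destruct (pow_lt_1_zero (1 / 2)) with (y := e / 2) as [K HK];
    [rewrite Rabs_pos_eq; lra|lra|].
  specialize (HK K (le_n K)). rewrite Rabs_pos_eq in HK by (apply pow_le; lra).
  apply prob_le_covered. exists (fun j => repeat x0 (K + j)). split.
  - intros w Hw. now apply HA in Hw.
  - intros N. specialize (Hx0 K N). lra.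
Qed.

Lemma of_nat_bound n : (fst (of_nat n) <= n /\ snd (of_nat n) <= n)%nat.
Proof.
  destruct (of_nat n) as [x y] eqn:E. pose proof (cancel_to_of n) as H.
  rewrite E in H. pose proof (to_nat_non_decreasing x y). simpl. lia.
Qed.

(** Cover the [j]-th set with slack [e / 2^j] and enumerate the double family by Cantor pairing. The
    first [N] pairs lie in an [N] by [N] square, which reduces the bound to finite sums. *)
Lemma prob_countable_union {X} (M : alphabet X) (A : nat -> (nat -> X) -> Prop) v V :
  (forall j, Prob (wt M) (A j) <= v j) ->
  (forall N, sumL v (seq 0 N) <= V) ->
  Prob (wt M) (fun w => exists j, A j w) <= V.
Proof.
  intros Hv HV. apply le_by_eps with 2; [lra|]. intros e He.
  assert (Hc : forall j, exists c : nat -> list X,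
    (forall w, A j w -> exists i, prefixOf (c i) w) /\
    forall N, sumL (fun i => cylW (wt M) (c i)) (seq 0 N) <= v j + e * (1 / 2) ^ j).
  { intros j. assert (Hj : 0 < e * (1 / 2) ^ j).
    { apply Rmult_lt_0_compat; [easy|]. apply pow_lt; lra. }
    destruct (prob_covered M (A j) _ Hj) as [c [H1 H2]]. exists c. split; [easy|].
    intros N. specialize (H2 N). specialize (Hv j). lra. }
  apply prob_le_covered.
  set (c := fun j => proj1_sig (constructive_indefinite_description _ (Hc j))).
  assert (H1 : forall j w, A j w -> exists i, prefixOf (c j i) w)
    by (intros j; apply (proj2_sig (constructive_indefinite_description _ (Hc j)))).
  assert (H2 : forall j N, sumL (fun i => cylW (wt M) (c j i)) (seq 0 N) <= v j + e * (1 / 2) ^ j)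
    by (intros j; apply (proj2_sig (constructive_indefinite_description _ (Hc j)))).
  exists (fun n => c (fst (of_nat n)) (snd (of_nat n))). split.
  - intros w [j Hj]. destruct (H1 j w Hj) as [i Hi]. exists (to_nat (j, i)).
    now rewrite cancel_of_to.
  - intros N.
    set (F := fun p : nat * nat => cylW (wt M) (c (fst p) (snd p))).
    assert (HF : forall p, 0 <= F p) by (intros; apply cylW_ge0, wt_ge0).
    apply Rle_trans with (sumL F (map of_nat (seq 0 N))); [rewrite sumL_map; apply Rle_refl|].
    apply Rle_trans with (sumL F (list_prod (seq 0 N) (seq 0 N))).
    + apply sumL_incl; [easy| |].
      * apply NoDup_map_NoDup_ForallPairs; [|apply seq_NoDup].
        intros x y _ _ H. rewrite <- (cancel_to_of x), <- (cancel_to_of y). now f_equal.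
      * intros p Hp. apply in_map_iff in Hp. destruct Hp as [n [Hn Hin]].
        apply in_seq in Hin. pose proof (of_nat_bound n). rewrite Hn in H.
        destruct p as [x y]. simpl in H. apply in_prod; apply in_seq; lia.
    + rewrite sumL_list_prod.
      apply Rle_trans with (sumL (fun j => v j + e * (1 / 2) ^ j) (seq 0 N)).
      * apply sumL_le. intros j _. apply (H2 j N).
      * rewrite sumL_add, sumL_scal. rewrite (Rmult_comm 2 e).
        apply Rplus_le_compat; [apply HV|].
        apply Rmult_le_compat_l; [lra|apply sumL_geometric].
Qed.

Lemma prob_union {X} (M : alphabet X) (A B : (nat -> X) -> Prop) :
  Prob (wt M) (fun w => A w \/ B w) <= Prob (wt M) A + Prob (wt M) B.
Proof.
  set (S := fun j : nat => match j with O => A | 1%nat => B | _ => fun _ => False end).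
  apply Rle_trans with (Prob (wt M) (fun w => exists j, S j w)).
  - apply prob_mono. intros w [H|H]; [now exists 0%nat|now exists 1%nat].
  - apply prob_countable_union with (fun j => Prob (wt M) (S j)); [intros; lra|].
    pose proof (prob_ge0 M A). pose proof (prob_ge0 M B).
    assert (H1 : forall n, sumL (fun j => Prob (wt M) (S j)) (seq 2 n) = 0).
    { intros n. rewrite (sumL_ext _ (fun _ => 0)); [apply sumL_zero|].
      intros j Hj. apply in_seq in Hj. destruct j as [|[|j]]; try lia.
      apply prob_empty. simpl. tauto. }
    intros [|[|N]]; simpl; [lra|lra|]. rewrite H1. lra.
Qed.

Lemma prob_list_union {X I} (M : alphabet X) (A : I -> (nat -> X) -> Prop) l :
  Prob (wt M) (fun w => exists i, In i l /\ A i w) <= sumL (fun i => Prob (wt M) (A i)) l.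
Proof.
  induction l as [|i l IH]; simpl.
  - apply Req_le. apply prob_empty. firstorder.
  - eapply Rle_trans; [|apply Rplus_le_compat_l, IH].
    eapply Rle_trans; [|apply prob_union]. apply prob_mono.
    intros w [k [[->|H] Hw]]; eauto.
Qed.

(** * Conditioning on prefixes; the whole space has measure one *)

Definition scons {X} (x : X) (w : nat -> X) : nat -> X :=
  fun i => match i with O => x | S i => w i end.

Lemma scons_eta {X} (w : nat -> X) : scons (w O) (fun i => w (S i)) = w.
Proof. apply functional_extensionality. now intros [|i]. Qed.

Lemma prob_cons {X} (M : alphabet X) x (A : (nat -> X) -> Prop) :
  Prob (wt M) (fun w => w O = x /\ A (fun i => w (S i))) <= wt M x * Prob (wt M) A.
Proof.
  apply le_by_eps with (wt M x); [apply wt_ge0|]. intros e He.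
  destruct (prob_covered M A e He) as [c [H1 H2]].
  apply prob_le_covered. exists (fun j => x :: c j). split.
  - intros w [Hx Hw]. destruct (H1 _ Hw) as [j Hj]. exists j. simpl. auto.
  - intros N. simpl. rewrite sumL_scal. specialize (H2 N).
    pose proof (wt_ge0 X M x). nra.
Qed.

Lemma prob_first_letter {X} (M : alphabet X) (A : (nat -> X) -> Prop) :
  Prob (wt M) A <= sumL (fun x => wt M x * Prob (wt M) (fun w => A (scons x w))) (letters M).
Proof.
  apply Rle_trans with (Prob (wt M) (fun w => exists x, In x (letters M) /\
    (w O = x /\ A (scons x (fun i => w (S i)))))).
  - apply prob_mono. intros w Hw. exists (w O). split; [apply letters_all|].
    now rewrite scons_eta.
  - eapply Rle_trans; [apply prob_list_union|]. apply sumL_le. intros x _.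
    apply (prob_cons M x (fun w => A (scons x w))).
Qed.

Fixpoint take {X} (m : nat) (w : nat -> X) : list X :=
  match m with
  | O => nil
  | S m => w O :: take m (fun i => w (S i))
  end.

Lemma take_length {X} m (w : nat -> X) : length (take m w) = m.
Proof. revert w. induction m; simpl; auto. Qed.

Lemma take_snoc {X} m (w : nat -> X) : take (S m) w = take m w ++ [w m].
Proof.
  revert w. induction m as [|m IH]; intros w; [easy|].
  change (take (S (S m)) w) with (w O :: take (S m) (fun i => w (S i))).
  now rewrite IH.
Qed.

Lemma firstn_take {X} m n (w : nat -> X) : (m <= n)%nat -> firstn m (take n w) = take m w.
Proof.
  revert n w. induction m as [|m IH]; intros n w H; [easy|].
  destruct n as [|n]; [lia|]. simpl. rewrite IH; [easy|lia].
Qed.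

(* Conditional measure of the cylinder [c] given the prefix [s]. *)
Fixpoint cond_cylW {X} (q : X -> R) (s c : list X) : R :=
  match s, c with
  | nil, _ => cylW q c
  | _, nil => 1
  | x :: s', y :: c' => if excluded_middle_informative (x = y) then cond_cylW q s' c' else 0
  end.

Lemma cond_cylW_ge0 {X} (q : X -> R) s c : (forall x, 0 <= q x) -> 0 <= cond_cylW q s c.
Proof.
  intros Hq. revert c. induction s as [|x s IH]; intros c; [now apply cylW_ge0|].
  destruct c as [|y c]; simpl; [lra|].
  destruct (excluded_middle_informative (x = y)); [easy|lra].
Qed.

(** Supermartingale property: averaging over the next letter does not raise the conditional weight,
    so some next letter does not raise the weight of a given finite family. *)
Lemma cond_cylW_average {X} (M : alphabet X) s c :
  sumL (fun x => wt M x * cond_cylW (wt M) (s ++ [x]) c) (letters M)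
    <= cond_cylW (wt M) s c.
Proof.
  revert c. induction s as [|x s IH]; intros [|y c]; simpl.
  - rewrite (sumL_ext _ (wt M)); [rewrite wt_sum; lra|intros; lra].
  - assert (Hc : 0 <= cylW (wt M) c) by apply cylW_ge0, wt_ge0.
    assert (H := sumL_single_le (letters M) y (fun x => wt M x * cylW (wt M) c)
      (letters_nodup X M) (Rmult_le_pos _ _ (wt_ge0 X M y) Hc)).
    eapply Rle_trans; [|apply H]. apply Req_le, sumL_ext. intros x _.
    destruct (excluded_middle_informative (x = y)); lra.
  - rewrite (sumL_ext _ (wt M)); [rewrite wt_sum; lra|intros; lra].
  - destruct (excluded_middle_informative (x = y)); [apply IH|].
    rewrite (sumL_ext _ (fun _ => 0)); [rewrite sumL_zero; lra|intros; lra].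
Qed.

Lemma cond_cylW_prefix {X} (q : X -> R) c w :
  prefixOf c w -> cond_cylW q (take (length c) w) c = 1.
Proof.
  revert w. induction c as [|y c IH]; intros w H; [easy|].
  destruct H as [H1 H2]. simpl.
  destruct (excluded_middle_informative (w O = y)); [now apply IH|easy].
Qed.

(** Compactness in disguise: if each letter of a finite alphabet violates a bound at some finite
    stage, all of them violate it at a common stage, where averaging over letters applies. *)
Lemma list_common_index {A} (P : A -> nat -> Prop) l :
  (forall x n m, (n <= m)%nat -> P x n -> P x m) ->
  (forall x, In x l -> exists n, P x n) -> exists n, forall x, In x l -> P x n.
Proof.
  intros Hm. induction l as [|x l IH]; intros H; [now exists O|].
  destruct IH as [n Hn]; [intros; apply H; simpl; auto|].
  destruct (H x) as [k Hk]; [simpl; auto|].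
  exists (n + k)%nat. intros y [->|Hy].
  - apply Hm with k; [lia|easy].
  - apply Hm with n; [lia|auto].
Qed.

(* If a cover had total weight below 1, one could extend prefixes letter by letter
   keeping the conditional weight of the cover below 1; the limit point is not covered. *)
Lemma prob_full {X} (M : alphabet X) : Prob (wt M) (fun _ => True) = 1.
Proof.
  apply Rle_antisym.
  { apply le_by_eps with 1; [lra|]. intros e He.
    destruct (small_cover M) as [x0 Hx0].
    destruct (pow_lt_1_zero (1 / 2)) with (y := e / 2) as [K HK];
      [rewrite Rabs_pos_eq; lra|lra|].
    specialize (HK K (le_n K)). rewrite Rabs_pos_eq in HK by (apply pow_le; lra).
    apply prob_le_covered.
    (* The empty word covers everything at cost 1; the other cylinders are padding. *)
    exists (fun j => match j with O => nil | S j => repeat x0 (K + j) end).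
    split; [now exists O|]. intros [|N]; [simpl; lra|].
    simpl. rewrite <- seq_shift, sumL_map. specialize (Hx0 K N). lra. }
  apply Rnot_lt_le. intros Hlt.
  destruct (prob_covered M (fun _ => True) ((1 - Prob (wt M) (fun _ => True)) / 2))
    as [c [H1 H2]]; [lra|].
  set (v := _ + _) in H2. assert (Hv : v < 1) by (unfold v; lra). clearbody v. clear Hlt.
  set (good := fun s => forall N, sumL (fun j => cond_cylW (wt M) s (c j)) (seq 0 N) <= v).
  assert (Hstep : forall s, exists x, good s -> good (s ++ [x])).
  { intros s. destruct (classic (good s)) as [Hs|Hs];
      [|destruct (wt_small X M) as [x _]; exists x; easy].
    apply NNPP. intros Hn.
    destruct (list_common_index
      (fun x N => v < sumL (fun j => cond_cylW (wt M) (s ++ [x]) (c j)) (seq 0 N))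
      (letters M)) as [N HN].
    - intros x n m Hnm H. eapply Rlt_le_trans; [apply H|].
      apply sumL_seq_mono; [|easy]. intros; apply cond_cylW_ge0, wt_ge0.
    - intros x _. apply NNPP. intros Hx. apply Hn. exists x. intros _ N.
      apply Rnot_lt_le. eauto.
    - destruct (sumL_average (wt M)
        (fun x => sumL (fun j => cond_cylW (wt M) (s ++ [x]) (c j)) (seq 0 N))
        (letters M) v) as [x [Hx Hle]].
      + apply wt_ge0.
      + apply wt_sum.
      + eapply Rle_trans; [|apply (Hs N)].
        rewrite (sumL_ext _ (fun x => sumL (fun j =>
          wt M x * cond_cylW (wt M) (s ++ [x]) (c j)) (seq 0 N)));
          [|intros; now rewrite sumL_scal].
        rewrite sumL_swap. apply sumL_le. intros j _. apply cond_cylW_average.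
      + specialize (HN x Hx). simpl in HN. lra. }
  set (next := fun s => proj1_sig (constructive_indefinite_description _ (Hstep s))).
  assert (Hnext : forall s, good s -> good (s ++ [next s]))
    by (intros s; apply (proj2_sig (constructive_indefinite_description _ (Hstep s)))).
  set (pre := fix pre n := match n with O => nil | S n => pre n ++ [next (pre n)] end).
  set (w := fun n => next (pre n)).
  assert (Hpre : forall n, pre n = take n w).
  { induction n as [|n IH]; [easy|]. rewrite take_snoc, <- IH. easy. }
  assert (Hgood : forall n, good (pre n)).
  { induction n as [|n IH]; [intros N; apply H2|]. now apply Hnext. }
  destruct (H1 w I) as [j Hj].
  (* At this length the prefix of [w] lies inside [c j], so the [j]-th term alone equals 1; the
     stage [S j] is the first partial sum containing it. *)
  specialize (Hgood (length (c j)) (S j)). rewrite Hpre in Hgood.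
  rewrite sumL_seq_S, cond_cylW_prefix in Hgood by easy.
  pose proof (sumL_ge0 (fun i => cond_cylW (wt M) (take (length (c j)) w) (c i)) (seq 0 j)
    (fun i _ => cond_cylW_ge0 (wt M) _ (c i) (wt_ge0 X M))). lra.
Qed.

(** * Weighted sums over words *)

Fixpoint sumW {X} (l : list X) (q : X -> R) (m : nat) (F : list X -> R) : R :=
  match m with
  | O => F nil
  | S m => sumL (fun x => q x * sumW l q m (fun s => F (x :: s))) l
  end.

Lemma sumW_ext {X} (l : list X) q m F G :
  (forall s, length s = m -> F s = G s) -> sumW l q m F = sumW l q m G.
Proof.
  revert F G. induction m as [|m IH]; intros F G H; simpl; [now apply H|].
  apply sumL_ext. intros x _. f_equal. apply IH. intros s Hs. apply H. simpl. auto.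
Qed.

Lemma sumW_le {X} (l : list X) q m F G :
  (forall x, 0 <= q x) -> (forall s, length s = m -> F s <= G s) ->
  sumW l q m F <= sumW l q m G.
Proof.
  intros Hq. revert F G. induction m as [|m IH]; intros F G H; simpl; [now apply H|].
  apply sumL_le. intros x _. apply Rmult_le_compat_l; [easy|].
  apply IH. intros s Hs. apply H. simpl. auto.
Qed.

Lemma sumW_add {X} (l : list X) q m F G :
  sumW l q m (fun s => F s + G s) = sumW l q m F + sumW l q m G.
Proof.
  revert F G. induction m as [|m IH]; intros F G; simpl; [easy|].
  rewrite <- sumL_add. apply sumL_ext. intros x _.
  rewrite (IH (fun s => F (x :: s)) (fun s => G (x :: s))). ring.
Qed.

Lemma sumW_scal {X} (l : list X) q m c F :
  sumW l q m (fun s => c * F s) = c * sumW l q m F.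
Proof.
  revert F. induction m as [|m IH]; intros F; simpl; [easy|].
  rewrite <- sumL_scal. apply sumL_ext. intros x _.
  rewrite (IH (fun s => F (x :: s))). ring.
Qed.

Lemma sumW_sub {X} (l : list X) q m F G :
  sumW l q m (fun s => F s - G s) = sumW l q m F - sumW l q m G.
Proof.
  rewrite (sumW_ext _ _ _ _ (fun s => F s + (-1) * G s)) by (intros; ring).
  rewrite sumW_add, sumW_scal. ring.
Qed.

Lemma sumW_const {X} (l : list X) q m c : sumL q l = 1 -> sumW l q m (fun _ => c) = c.
Proof.
  intros H. induction m as [|m IH]; simpl; [easy|].
  rewrite IH, (sumL_ext _ (fun x => c * q x)) by (intros; ring).
  rewrite sumL_scal. change (fun x => q x) with q. rewrite H. ring.
Qed.

Lemma sumW_zero {X} (l : list X) q m : sumW l q m (fun _ => 0) = 0.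
Proof.
  induction m as [|m IH]; simpl; [easy|].
  rewrite (sumL_ext _ (fun _ => 0)); [apply sumL_zero|]. intros. rewrite IH. ring.
Qed.

Lemma sumW_ge0 {X} (l : list X) q m F :
  (forall x, 0 <= q x) -> (forall s, length s = m -> 0 <= F s) -> 0 <= sumW l q m F.
Proof. intros Hq H. rewrite <- (sumW_zero l q m). now apply sumW_le. Qed.

Lemma sumW_abs {X} (l : list X) q m F :
  (forall x, 0 <= q x) -> Rabs (sumW l q m F) <= sumW l q m (fun s => Rabs (F s)).
Proof.
  intros Hq. apply Rabs_le. split.
  - replace (- sumW l q m (fun s => Rabs (F s))) with
      (sumW l q m (fun s => (-1) * Rabs (F s))) by (rewrite sumW_scal; ring).
    apply sumW_le; [easy|]. intros s _. pose proof (Rle_abs (- F s)).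
    rewrite Rabs_Ropp in H. lra.
  - apply sumW_le; [easy|]. intros s _. apply Rle_abs.
Qed.

Lemma sumW_sumL {X I} (l : list X) q m (F : I -> list X -> R) (r : list I) :
  sumW l q m (fun s => sumL (fun i => F i s) r) = sumL (fun i => sumW l q m (F i)) r.
Proof.
  induction r as [|i r IH]; simpl; [apply sumW_zero|].
  now rewrite sumW_add, IH.
Qed.

Lemma sumW_swap {X Y} (l : list X) q m (l' : list Y) q' n (F : list X -> list Y -> R) :
  sumW l q m (fun s => sumW l' q' n (fun u => F s u)) =
  sumW l' q' n (fun u => sumW l q m (fun s => F s u)).
Proof.
  revert F. induction n as [|n IH]; intros F; simpl; [easy|].
  rewrite (sumW_sumL l q m (fun y s => q' y * sumW l' q' n (fun u => F s (y :: u)))).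
  apply sumL_ext. intros y _. rewrite sumW_scal. f_equal.
  apply (IH (fun s u => F s (y :: u))).
Qed.

Lemma sumW_app {X} (l : list X) q m n F :
  sumW l q (m + n) F = sumW l q m (fun s => sumW l q n (fun u => F (s ++ u))).
Proof.
  revert F. induction m as [|m IH]; intros F; simpl; [easy|].
  apply sumL_ext. intros x _. f_equal. apply (IH (fun s => F (x :: s))).
Qed.

Definition ind (b : bool) : R := if b then 1 else 0.

Lemma prob_take_le {X} (M : alphabet X) m (C : list X -> bool) :
  Prob (wt M) (fun w => C (take m w) = true)
    <= sumW (letters M) (wt M) m (fun s => ind (C s)).
Proof.
  revert C. induction m as [|m IH]; intros C; simpl.
  - destruct (C nil); simpl.
    + rewrite <- (prob_full M). now apply prob_mono.
    + apply Req_le, prob_empty. easy.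
  - eapply Rle_trans; [apply prob_first_letter|].
    apply sumL_le. intros x _. apply Rmult_le_compat_l; [apply wt_ge0|].
    apply (IH (fun s => C (x :: s))).
Qed.

(** The upper bounds for an event and for its complement add up to 1, and by subadditivity the two
    probabilities add up to at least 1; hence both bounds are equalities. *)
Lemma prob_take {X} (M : alphabet X) m (C : list X -> bool) :
  Prob (wt M) (fun w => C (take m w) = true)
    = sumW (letters M) (wt M) m (fun s => ind (C s)).
Proof.
  apply Rle_antisym; [apply prob_take_le|].
  pose proof (prob_take_le M m (fun s => negb (C s))) as H1.
  rewrite (sumW_ext _ _ _ _ (fun s => 1 - ind (C s))) in H1
    by (intros s _; destruct (C s); simpl; ring).
  rewrite sumW_sub, sumW_const in H1 by apply wt_sum.
  pose proof (prob_full M) as H2.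
  pose proof (prob_union M (fun w => C (take m w) = true)
    (fun w => negb (C (take m w)) = true)) as H3.
  assert (H4 : Prob (wt M) (fun _ => True) <= Prob (wt M) (fun w =>
    C (take m w) = true \/ negb (C (take m w)) = true)).
  { apply prob_mono. intros w _. destruct (C (take m w)); auto. }
  lra.
Qed.

(** * Events determined by finitely many letters, and approximation by them *)

Definition extend {X} (x0 : X) (s : list X) : nat -> X := fun i => nth i s x0.

Lemma take_extend {X} (x0 : X) s : take (length s) (extend x0 s) = s.
Proof.
  induction s as [|x s IH]; simpl; [easy|].
  f_equal. exact IH.
Qed.

Definition depends {X Y} (m : nat) (g : (nat -> X) -> Y) : Prop :=
  forall w w', take m w = take m w' -> g w = g w'.

Lemma depends_take {X Y} x0 m (g : (nat -> X) -> Y) w :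
  depends m g -> g w = g (extend x0 (take m w)).
Proof.
  intros H. apply H. pose proof (take_extend x0 (take m w)) as E.
  now rewrite take_length in E.
Qed.

Lemma depends_mono {X Y} m n (g : (nat -> X) -> Y) :
  (m <= n)%nat -> depends m g -> depends n g.
Proof.
  intros Hmn H w w' E. apply H. now rewrite <- !(firstn_take m n), E.
Qed.

Lemma prob_depends {X} (M : alphabet X) x0 m (g : (nat -> X) -> bool) :
  depends m g ->
  Prob (wt M) (fun w => g w = true)
    = sumW (letters M) (wt M) m (fun s => ind (g (extend x0 s))).
Proof.
  intros H. rewrite <- (prob_take M m (fun s => g (extend x0 s))).
  apply prob_ext. intros w. now rewrite <- (depends_take x0 m g w).
Qed.

Lemma prob_depends_split {X} (M : alphabet X) m (g h : (nat -> X) -> bool) :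
  depends m g -> depends m h ->
  Prob (wt M) (fun w => g w = true) =
  Prob (wt M) (fun w => (g w && h w)%bool = true) +
  Prob (wt M) (fun w => (g w && negb (h w))%bool = true).
Proof.
  intros Hg Hh. destruct (wt_small X M) as [x0 _].
  rewrite (prob_depends M x0 m g), (prob_depends M x0 m (fun w => g w && h w)%bool),
    (prob_depends M x0 m (fun w => g w && negb (h w))%bool); auto.
  - rewrite <- sumW_add. apply sumW_ext. intros s _.
    destruct (g (extend x0 s)), (h (extend x0 s)); simpl; ring.
  - intros w w' E. now rewrite (Hg w w'), (Hh w w').
  - intros w w' E. now rewrite (Hg w w'), (Hh w w').
Qed.

(** Closeness is the outer measure of the symmetric difference. This form survives complements and
    countable unions, hence reaches every set in [meas] by induction. *)
Definition approximable {X} (M : alphabet X) (A : (nat -> X) -> Prop) : Prop :=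
  forall e, 0 < e -> exists m g, depends m g /\
    Prob (wt M) (fun w => ~ (A w <-> g w = true)) <= e.

Lemma prefixOf_take {X} (s : list X) w : prefixOf s w <-> take (length s) w = s.
Proof.
  revert w. induction s as [|x s IH]; intros w; simpl; [easy|].
  rewrite IH. split; [intros [-> ->]; easy|]. intros H; now injection H.
Qed.

(* The tail of the union is controlled by the increments of a bounded increasing
   sequence of probabilities, via the first index at which a point is caught. *)
Lemma approximable_union {X} (M : alphabet X) (A : nat -> (nat -> X) -> Prop) :
  (forall n, approximable M (A n)) -> approximable M (fun w => exists n, A n w).
Proof.
  intros HA e He.
  assert (HA' : forall n, exists p : nat * ((nat -> X) -> bool), depends (fst p) (snd p) /\
    Prob (wt M) (fun w => ~ (A n w <-> snd p w = true)) <= e / 4 * (1 / 2) ^ n).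
  { intros n. destruct (HA n (e / 4 * (1 / 2) ^ n)) as [m [g Hg]].
    - apply Rmult_lt_0_compat; [lra|]. apply pow_lt; lra.
    - now exists (m, g). }
  set (g := fun n => snd (proj1_sig (constructive_indefinite_description _ (HA' n)))).
  set (m := fun n => fst (proj1_sig (constructive_indefinite_description _ (HA' n)))).
  assert (Hg : forall n, depends (m n) (g n))
    by (intros n; apply (proj2_sig (constructive_indefinite_description _ (HA' n)))).
  assert (HP : forall n, Prob (wt M) (fun w => ~ (A n w <-> g n w = true))
      <= e / 4 * (1 / 2) ^ n)
    by (intros n; apply (proj2_sig (constructive_indefinite_description _ (HA' n)))).
  clearbody g m.
  set (u := fix u n w := match n with O => false | S n => (u n w || g n w)%bool end).
  set (mu := fix mu n := match n with O => O | S n => Nat.max (mu n) (m n) end).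
  assert (Hu : forall n, depends (mu n) (u n)).
  { induction n as [|n IH]; [now intros w w' _|]. intros w w' E. simpl.
    f_equal.
    - apply (depends_mono (mu n) (mu (S n))); [simpl; lia|easy|easy].
    - apply (depends_mono (m n) (mu (S n))); [simpl; lia|easy|easy]. }
  set (p := fun n => Prob (wt M) (fun w => u n w = true)).
  assert (Hinc : forall n,
    p (S n) = p n + Prob (wt M) (fun w => (g n w && negb (u n w))%bool = true)).
  { intros n. unfold p. rewrite (prob_depends_split M (mu (S n)) (u (S n)) (u n)).
    - f_equal; apply prob_ext; intros w; simpl; destruct (u n w), (g n w); simpl; easy.
    - apply Hu.
    - apply depends_mono with (mu n); [simpl; lia|apply Hu]. }
  assert (Hgrow : Un_growing p).
  { intros n. rewrite Hinc. pose proof (prob_ge0 M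
      (fun w => (g n w && negb (u n w))%bool = true)). lra. }
  destruct (growing_cv p Hgrow) as [l Hl].
  { exists 1. intros x [n ->]. rewrite <- (prob_full M). now apply prob_mono. }
  destruct (Hl (e / 2)) as [N HN]; [lra|]. specialize (HN N (le_n N)).
  pose proof (growing_ineq p l Hgrow Hl) as Hpl.
  unfold Rdist in HN. apply Rabs_def2 in HN.
  exists (mu N), (u N). split; [apply Hu|].
  assert (Hu_ge : forall n k w, (n < k)%nat -> g n w = true -> u k w = true).
  { intros n k w Hnk Hn. induction Hnk as [|k Hnk IH]; simpl.
    - rewrite Hn. apply Bool.orb_true_r.
    - now rewrite IH. }
  assert (Hu_ex : forall n w, u n w = true ->
    exists k, (k < n)%nat /\ g k w = true /\ u k w = false).
  { induction n as [|n IH]; intros w Hw; simpl in Hw; [easy|].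
    destruct (u n w) eqn:E.
    - destruct (IH w E) as [k [H1 H2]]. exists k. split; [lia|easy].
    - exists n. auto. }
  apply Rle_trans with (Prob (wt M) (fun w =>
    (exists n, ~ (A n w <-> g n w = true)) \/
    (exists n, (N <= n)%nat /\ (g n w && negb (u n w))%bool = true))).
  { apply prob_mono. intros w Hw. apply NNPP. intros Hn. apply Hw.
    assert (HAg : forall n, A n w <-> g n w = true).
    { intros n. apply NNPP. eauto. }
    split.
    - intros [n Hn1]. apply HAg in Hn1.
      destruct (Hu_ex (S n) w) as [k [Hk1 [Hk2 Hk3]]].
      { apply Hu_ge with n; [lia|easy]. }
      destruct (Nat.le_gt_cases N k) as [HNk|HNk].
      + exfalso. apply Hn. right. exists k. now rewrite Hk2, Hk3.
      + now apply Hu_ge with k.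
    - intros Hu1. destruct (Hu_ex N w Hu1) as [k [_ [Hk _]]]. exists k. now apply HAg. }
  eapply Rle_trans; [apply prob_union|].
  (* The errors [e / 4 * (1 / 2) ^ n] sum to at most [e / 2]. The points caught first at an index
     [n >= N] have probabilities that telescope to at most [l - p N < e / 2]. *)
  replace e with (e / 2 + e / 2) by lra. apply Rplus_le_compat.
  - apply prob_countable_union with (fun n => e / 4 * (1 / 2) ^ n); [easy|].
    intros K. rewrite sumL_scal. replace (e / 2) with (e / 4 * 2) by lra.
    apply Rmult_le_compat_l; [lra|apply sumL_geometric].
  - apply prob_countable_union with
      (fun n => if (N <=? n)%nat then p (S n) - p n else 0).
    + intros n. destruct (Nat.leb_spec N n) as [H|H].
      * rewrite Hinc. ring_simplify. apply prob_mono. easy.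
      * apply Req_le, prob_empty. intros w [H1 _]. lia.
    + intros K.
      assert (HK : sumL (fun n => if (N <=? n)%nat then p (S n) - p n else 0) (seq 0 K)
        = if (N <=? K)%nat then p K - p N else 0).
      { induction K as [|K IH].
        - simpl. destruct (Nat.leb_spec N 0) as [H|H]; [|easy].
          replace N with O by lia. ring.
        - rewrite sumL_seq_S, IH.
          destruct (Nat.leb_spec N K), (Nat.leb_spec N (S K)); try lia; try ring.
          replace N with (S K) by lia. ring. }
      rewrite HK. destruct (Nat.leb_spec N K); [|lra].
      specialize (Hpl K). lra.
Qed.

Lemma meas_approximable {X} (M : alphabet X) A : meas A -> approximable M A.
Proof.
  intros H. induction H as [s|A _ IH|A _ IH|A B HAB _ IH].
  - intros e He. exists (length s), (fun w =>
      if excluded_middle_informative (take (length s) w = s) then true else false).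
    split.
    + intros w w' E. now rewrite E.
    + apply Rle_trans with 0; [|lra]. apply Req_le, prob_empty. intros w Hw. apply Hw.
      rewrite prefixOf_take. destruct (excluded_middle_informative _); easy.
  - intros e He. destruct (IH e He) as [m [g [H1 H2]]].
    exists m, (fun w => negb (g w)). split.
    + intros w w' E. now rewrite (H1 w w').
    + eapply Rle_trans; [|apply H2]. apply prob_mono. intros w Hw Hn. apply Hw.
      rewrite Hn. destruct (g w); simpl; split; congruence.
  - now apply approximable_union.
  - intros e He. destruct (IH e He) as [m [g [H1 H2]]]. exists m, g. split; [easy|].
    eapply Rle_trans; [|apply H2]. apply prob_mono. intros w Hw. now rewrite HAB.
Qed.

(** * Images under coordinatewise maps; Cauchy-Schwarz *)

Lemma prob_push_cyl {X Y} (M : alphabet X) (M' : alphabet Y) (phi : nat -> X -> Y) s :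
  (forall i y, sumL (fun x => if excluded_middle_informative (phi i x = y)
     then wt M x else 0) (letters M) <= wt M' y) ->
  Prob (wt M) (fun t => prefixOf s (fun i => phi i (t i))) <= cylW (wt M') s.
Proof.
  revert phi. induction s as [|y s IH]; intros phi H; simpl.
  - rewrite prob_full. lra.
  - eapply Rle_trans; [apply prob_first_letter|].
    assert (Hs : 0 <= cylW (wt M') s) by apply cylW_ge0, wt_ge0.
    apply Rle_trans with (sumL (fun x => cylW (wt M') s *
      (if excluded_middle_informative (phi O x = y) then wt M x else 0)) (letters M)).
    + apply sumL_le. intros x _.
      destruct (excluded_middle_informative (phi O x = y)) as [E|E].
      * rewrite Rmult_comm. apply Rmult_le_compat_r; [apply wt_ge0|].
        eapply Rle_trans; [|apply (IH (fun i => phi (S i))); intros; apply H].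
        apply prob_mono. intros w Hw. apply Hw.
      * rewrite prob_empty; [lra|]. intros w [Hw _]. now apply E.
    + rewrite sumL_scal, Rmult_comm. apply Rmult_le_compat_r; [easy|]. apply H.
Qed.

(** Pull a cover back: the preimage of a cylinder need not be a cylinder, but its outer measure is
    at most the weight of that cylinder. The map may depend on the position, so this serves both the
    two marginals of the noise and the flip of a single bit. *)
Lemma prob_push {X Y} (M : alphabet X) (M' : alphabet Y) (phi : nat -> X -> Y) A :
  (forall i y, sumL (fun x => if excluded_middle_informative (phi i x = y)
     then wt M x else 0) (letters M) <= wt M' y) ->
  Prob (wt M) (fun t => A (fun i => phi i (t i))) <= Prob (wt M') A.
Proof.
  intros H. apply le_by_eps with 1; [lra|]. intros e He. rewrite Rmult_1_l.
  destruct (prob_covered M' A e He) as [c [H1 H2]].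
  apply Rle_trans with (Prob (wt M) (fun t =>
    exists j, prefixOf (c j) (fun i => phi i (t i)))).
  - apply prob_mono. auto.
  - apply prob_countable_union with (fun j => cylW (wt M') (c j)); [|easy].
    intros j. now apply prob_push_cyl.
Qed.

Lemma sumW_cauchy_schwarz {X} (l : list X) q m F G :
  (forall x, 0 <= q x) ->
  (sumW l q m (fun s => F s * G s)) ^ 2
    <= sumW l q m (fun s => F s ^ 2) * sumW l q m (fun s => G s ^ 2).
Proof.
  intros Hq.
  set (a := sumW l q m (fun s => F s ^ 2)). set (c := sumW l q m (fun s => G s ^ 2)).
  set (b := sumW l q m (fun s => F s * G s)).
  assert (H : forall t, 0 <= a - 2 * t * b + t ^ 2 * c).
  { intros t. apply Rle_trans with (sumW l q m (fun s => (F s - t * G s) ^ 2)).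
    - apply sumW_ge0; [easy|]. intros s _. apply pow2_ge_0.
    - apply Req_le. unfold a, b, c.
      rewrite <- !sumW_scal, <- sumW_sub, <- sumW_add. apply sumW_ext.
      intros s _. ring. }
  assert (Hc : 0 <= c) by (apply sumW_ge0; [easy|]; intros; apply pow2_ge_0).
  destruct (Req_dec c 0) as [E|E].
  - destruct (Req_dec b 0) as [->|Eb]; [rewrite E; lra|].
    (* If [c = 0], the quadratic in [t] is affine with slope [- 2 b]; at this [t] it takes the value
       -1. *)
    specialize (H ((a + 1) / (2 * b))). rewrite E in H.
    replace (a - 2 * ((a + 1) / (2 * b)) * b + ((a + 1) / (2 * b)) ^ 2 * 0) with (-1) in H
      by (field; easy). lra.
  - specialize (H (b / c)).
    replace (a - 2 * (b / c) * b + (b / c) ^ 2 * c) with ((a * c - b ^ 2) / c) in H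
      by (field; easy).
    apply Rmult_le_compat_r with (r := c) in H; [|easy].
    replace ((a * c - b ^ 2) / c * c) with (a * c - b ^ 2) in H by (field; easy). lra.
Qed.

(** * Fourier analysis on the discrete cube *)

Definition avg (m : nat) (F : list bool -> R) : R := sumW [true; false] qU m F.
Definition tot (m : nat) (F : list bool -> R) : R := sumW [true; false] (fun _ => 1) m F.

Lemma qU_ge0 b : 0 <= qU b.
Proof. unfold qU. lra. Qed.

Lemma qU_sum : sumL qU [true; false] = 1.
Proof. unfold qU. simpl. lra. Qed.

Lemma one_ge0 (b : bool) : 0 <= 1.
Proof. lra. Qed.

#[local] Hint Resolve qU_ge0 qU_sum one_ge0 : core.

Lemma avg_S m F : avg (S m) F = (avg m (fun s => F (true :: s)) + avg m (fun s => F (false :: s))) / 2.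
Proof. unfold avg. simpl. unfold qU at 1 3. lra. Qed.

Lemma tot_S m F : tot (S m) F = tot m (fun s => F (true :: s)) + tot m (fun s => F (false :: s)).
Proof. unfold tot. simpl. lra. Qed.

Lemma pm_sq b : pm b * pm b = 1.
Proof. destruct b; simpl; ring. Qed.

Fixpoint flipL (k : nat) (s : list bool) {struct s} : list bool :=
  match s, k with
  | nil, _ => nil
  | b :: t, O => negb b :: t
  | b :: t, S k => b :: flipL k t
  end.

Lemma flipL_involutive k s : flipL k (flipL k s) = s.
Proof.
  revert k. induction s as [|b s IH]; intros [|k]; simpl; try easy.
  - now rewrite Bool.negb_involutive.
  - now rewrite IH.
Qed.

Lemma nth_flipL k s :
  (k < length s)%nat -> nth k (flipL k s) false = negb (nth k s false).
Proof.
  revert k. induction s as [|b s IH]; intros [|k] H; simpl in *; try lia; auto.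
  apply IH. lia.
Qed.

Lemma nth_flipL_neq j k s : j <> k -> nth j (flipL k s) false = nth j s false.
Proof.
  revert j k. induction s as [|b s IH]; intros [|j] [|k] H; simpl; try easy; try lia. apply IH. lia.
Qed.

Lemma sumW_flipL q m k F : (forall a b, q a = q b) ->
  sumW [true; false] q m (fun s => F (flipL k s)) = sumW [true; false] q m F.
Proof.
  intros Hq. revert k F. induction m as [|m IH]; intros k F; simpl; [easy|].
  destruct k as [|k]; simpl.
  - rewrite (Hq true false). ring.
  - now rewrite (IH k (fun s => F (true :: s))), (IH k (fun s => F (false :: s))).
Qed.

Lemma avg_flipL m k F : avg m (fun s => F (flipL k s)) = avg m F.
Proof. now apply sumW_flipL. Qed.

Lemma tot_flipL m k F : tot m (fun s => F (flipL k s)) = tot m F.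
Proof. now apply sumW_flipL. Qed.

Lemma avg_odd m k F :
  (forall s, length s = m -> F (flipL k s) = - F s) -> avg m F = 0.
Proof.
  intros H. assert (E : avg m F = (-1) * avg m F); [|lra].
  rewrite <- (avg_flipL m k F) at 1. unfold avg. rewrite <- sumW_scal.
  apply sumW_ext. intros s Hs. rewrite H by easy. ring.
Qed.

(* Subsets of coordinates are encoded by their indicator words. *)
Fixpoint chi (S x : list bool) : R :=
  match S, x with
  | b :: S', a :: x' => (if b then pm a else 1) * chi S' x'
  | _, _ => 1
  end.

Fixpoint cnt (S : list bool) : nat :=
  match S with
  | nil => O
  | b :: S' => ((if b then 1 else 0) + cnt S')%nat
  end.

Fixpoint cap (S T : list bool) : nat :=
  match S, T with
  | b :: S', a :: T' => ((if b then (if a then 1 else 0) else 0) + cap S' T')%nat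
  | _, _ => O
  end.

Lemma chi_flipL_set k S x :
  length S = length x -> (k < length x)%nat ->
  chi (flipL k S) x = pm (nth k x false) * chi S x.
Proof.
  revert k x. induction S as [|b S IH]; intros k [|a x] H Hk; simpl in *; try lia.
  destruct k as [|k]; simpl.
  - destruct b; simpl; [|ring]. rewrite <- Rmult_assoc, pm_sq. ring.
  - rewrite IH by lia. ring.
Qed.

Lemma chi_flipL_point k S x : nth k S false = false -> chi S (flipL k x) = chi S x.
Proof.
  revert k x. induction S as [|b S IH]; intros k [|a x] H; simpl; try easy.
  destruct k as [|k]; simpl in *; [now rewrite H|]. now rewrite IH.
Qed.

Lemma cap_0_nth S T k : length S = length T -> cap S T = O ->
  nth k T false = true -> nth k S false = false.
Proof.
  revert T k. induction S as [|b S IH]; intros [|a T] k HL H Hk; simpl in *; try easy.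
  - now destruct k.
  - destruct k as [|k]; [subst a; destruct b; [lia|easy]|].
    apply IH with T; [lia| |easy]. lia.
Qed.

Lemma cap_1_flipL S T : length S = length T -> cap S T = 1%nat ->
  exists i, (i < length T)%nat /\ nth i T false = true /\
    cap (flipL i S) T = O /\ cnt S = Datatypes.S (cnt (flipL i S)).
Proof.
  revert T. induction S as [|b S IH]; intros [|a T] HL H; simpl in *; try lia.
  destruct b, a; simpl in *.
  - exists O. simpl. repeat split; lia.
  - destruct (IH T) as [i [H1 [H2 [H3 H4]]]]; [lia|lia|].
    exists (Datatypes.S i). simpl. repeat split; [lia|easy|easy|lia].
  - destruct (IH T) as [i [H1 [H2 [H3 H4]]]]; [lia|lia|].
    exists (Datatypes.S i). simpl. repeat split; [lia|easy|easy|lia].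
  - destruct (IH T) as [i [H1 [H2 [H3 H4]]]]; [lia|lia|].
    exists (Datatypes.S i). simpl. repeat split; [lia|easy|easy|lia].
Qed.

(** * Walsh expansions and fourth moments *)

Definition hat (m : nat) (f : list bool -> R) (S : list bool) : R :=
  avg m (fun x => f x * chi S x).

Definition walsh (m : nat) (c : list bool -> R) (x : list bool) : R :=
  tot m (fun S => c S * chi S x).

Lemma walsh_cons m c a x :
  walsh (S m) c (a :: x) =
  pm a * walsh m (fun S => c (true :: S)) x + walsh m (fun S => c (false :: S)) x.
Proof.
  unfold walsh. rewrite tot_S. f_equal.
  - unfold tot. rewrite <- sumW_scal. apply sumW_ext. intros s _. simpl. ring.
  - unfold tot. apply sumW_ext. intros s _. simpl. ring.
Qed.

Lemma hat_cons m f b S :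
  hat (Datatypes.S m) f (b :: S) =
  if b then (hat m (fun x => f (true :: x)) S - hat m (fun x => f (false :: x)) S) / 2
  else (hat m (fun x => f (true :: x)) S + hat m (fun x => f (false :: x)) S) / 2.
Proof.
  unfold hat. rewrite avg_S. unfold avg. destruct b.
  - rewrite <- sumW_sub, <- sumW_add. f_equal. apply sumW_ext. intros s _. simpl. ring.
  - rewrite <- !sumW_add. f_equal. apply sumW_ext. intros s _. simpl. ring.
Qed.

(** Split off the first bit: the values at that bit are [P0 + P1] and [P0 - P1], and their squares
    average to [P0^2 + P1^2]. [parseval] uses the same identity in the other direction. *)
Lemma walsh_norm m c : avg m (fun x => walsh m c x ^ 2) = tot m (fun S => c S ^ 2).
Proof.
  revert c. induction m as [|m IH]; intros c.
  - unfold avg, walsh, tot. simpl. ring.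
  - rewrite avg_S, tot_S, <- !IH. unfold avg. rewrite <- !sumW_add.
    unfold Rdiv. rewrite Rmult_comm, <- sumW_scal. apply sumW_ext. intros x _.
    rewrite !walsh_cons. simpl. field.
Qed.

Lemma parseval m f : avg m (fun x => f x ^ 2) = tot m (fun S => hat m f S ^ 2).
Proof.
  revert f. induction m as [|m IH]; intros f.
  - unfold avg, hat, avg, tot. simpl. ring.
  - rewrite avg_S, tot_S, !IH. unfold tot. rewrite <- !sumW_add.
    unfold Rdiv. rewrite Rmult_comm, <- sumW_scal. apply sumW_ext. intros S _.
    rewrite !hat_cons. simpl. field.
Qed.

Lemma pow4_ge0 x : 0 <= x ^ 4.
Proof. replace (x ^ 4) with ((x ^ 2) ^ 2) by ring. apply pow2_ge_0. Qed.

(* Bonami's lemma. *)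
Lemma walsh_fourth_moment m k c :
  (forall S, length S = m -> (k < cnt S)%nat -> c S = 0) ->
  avg m (fun x => walsh m c x ^ 4) <= 9 ^ k * (avg m (fun x => walsh m c x ^ 2)) ^ 2.
Proof.
  revert k c. induction m as [|m IH]; intros k c Hc.
  - unfold avg, walsh, tot. simpl. assert (1 <= 9 ^ k) by (apply pow_R1_Rle; lra).
    set (z := c nil * 1).
    pose proof (Rle_0_sqr (z * z)). unfold Rsqr in *.
    replace (z * (z * (z * (z * 1)))) with (1 * (z * z * (z * z))) by ring.
    replace (z * (z * 1) * (z * (z * 1) * 1)) with (z * z * (z * z)) by ring.
    now apply Rmult_le_compat_r.
  (* The polynomial is [P0 + x P1] with [x] the first sign. Odd powers of [x] average out, leaving
     [P0^4 + 6 P0^2 P1^2 + P1^4]. [P1] has degree one less, which gains a factor 9, and it vanishes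
     when [k] is 0. *)
  - set (P1 := walsh m (fun S => c (true :: S))).
    set (P0 := walsh m (fun S => c (false :: S))).
    set (A := avg m (fun x => P0 x ^ 2)). set (B := avg m (fun x => P1 x ^ 2)).
    set (Q := avg m (fun x => P0 x ^ 2 * P1 x ^ 2)).
    assert (E2 : avg (S m) (fun x => walsh (S m) c x ^ 2) = A + B).
    { rewrite avg_S. unfold A, B, avg. rewrite <- !sumW_add.
      unfold Rdiv. rewrite Rmult_comm, <- sumW_scal. apply sumW_ext. intros x _.
      rewrite !walsh_cons. fold P0 P1. simpl. field. }
    assert (E4 : avg (S m) (fun x => walsh (S m) c x ^ 4) =
      avg m (fun x => P0 x ^ 4) + 6 * Q + avg m (fun x => P1 x ^ 4)).
    { rewrite avg_S. unfold Q, avg. rewrite <- !sumW_scal, <- !sumW_add.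
      unfold Rdiv. rewrite Rmult_comm, <- sumW_scal. apply sumW_ext. intros x _.
      rewrite !walsh_cons. fold P0 P1. simpl. field. }
    rewrite E2, E4.
    assert (HA : 0 <= A) by (apply sumW_ge0; [auto|]; intros; apply pow2_ge_0).
    assert (HB : 0 <= B) by (apply sumW_ge0; [auto|]; intros; apply pow2_ge_0).
    assert (H0 : avg m (fun x => P0 x ^ 4) <= 9 ^ k * A ^ 2).
    { apply IH. intros S HS Hk. apply Hc; simpl; auto. }
    destruct k as [|k].
    + assert (HP : forall x, P1 x = 0).
      { intros x. unfold P1, walsh, tot.
        rewrite (sumW_ext _ _ _ _ (fun _ => 0)); [apply sumW_zero|].
        intros S HS. rewrite Hc; [ring|simpl; auto|simpl; lia]. }
      assert (EQ : Q = 0).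
      { unfold Q, avg. rewrite (sumW_ext _ _ _ _ (fun _ => 0)); [apply sumW_zero|].
        intros x _. rewrite HP. ring. }
      assert (E1 : avg m (fun x => P1 x ^ 4) = 0).
      { unfold avg. rewrite (sumW_ext _ _ _ _ (fun _ => 0)); [apply sumW_zero|].
        intros x _. rewrite HP. ring. }
      rewrite EQ, E1. simpl in *. nra.
    + assert (H1 : avg m (fun x => P1 x ^ 4) <= 9 ^ k * B ^ 2).
      { apply IH. intros S HS Hk. apply Hc; simpl; lia. }
      pose proof (sumW_cauchy_schwarz [true; false] qU m (fun x => P0 x ^ 2)
        (fun x => P1 x ^ 2) qU_ge0) as H2.
      rewrite (sumW_ext _ _ _ (fun s => (P0 s ^ 2) ^ 2) (fun x => P0 x ^ 4)) in H2
        by (intros; ring).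
      rewrite (sumW_ext _ _ _ (fun s => (P1 s ^ 2) ^ 2) (fun x => P1 x ^ 4)) in H2
        by (intros; ring).
      fold (avg m (fun x => P0 x ^ 4)) (avg m (fun x => P1 x ^ 4)) in H2.
      change (Q ^ 2 <= avg m (fun x => P0 x ^ 4) * avg m (fun x => P1 x ^ 4)) in H2.
      assert (H9 : 0 < 9 ^ k) by (apply pow_lt; lra).
      (* Cauchy-Schwarz, with [3 * 9^k] the square root of [9^(k+1) * 9^k]. Then [6 * 3 = 2 * 9]
         matches exactly the cross term of [9^(k+1) (A + B)^2]. *)
      assert (HQ : Q <= 3 * 9 ^ k * (A * B)).
      { apply Rsqr_incr_0_var.
        - unfold Rsqr. replace (Q * Q) with (Q ^ 2) by ring.
          eapply Rle_trans; [apply H2|].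
          apply Rle_trans with ((9 ^ (S k) * A ^ 2) * (9 ^ k * B ^ 2)).
          + apply Rmult_le_compat; try easy;
              (apply sumW_ge0; [auto|]; intros x _; apply pow4_ge0).
          + apply Req_le. simpl. ring.
        - apply Rmult_le_pos; [lra|]. now apply Rmult_le_pos. }
      replace (9 ^ S k) with (9 * 9 ^ k) in * by (simpl; ring).
      set (z := 9 ^ k) in *.
      apply Rle_trans with (9 * z * A ^ 2 + 6 * (3 * z * (A * B)) + z * B ^ 2); [lra|].
      assert (0 <= z * B ^ 2) by (apply Rmult_le_pos; [lra|apply pow2_ge_0]).
      replace (9 * z * (A + B) ^ 2) with
        (9 * z * A ^ 2 + 6 * (3 * z * (A * B)) + 9 * (z * B ^ 2)) by ring. lra.
Qed.

(** * Influences bound the Fourier weight of each level *)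

Lemma avg_le m F G : (forall s, length s = m -> F s <= G s) -> avg m F <= avg m G.
Proof. intros H. apply sumW_le; auto. Qed.

Lemma tot_le m F G : (forall s, length s = m -> F s <= G s) -> tot m F <= tot m G.
Proof. intros H. apply sumW_le; auto. Qed.

(** The factor 1/2 makes this the probability of a change when [f] takes the values 1 and -1. *)
Definition infl (m : nat) (f : list bool -> R) (i : nat) : R :=
  avg m (fun x => Rabs (f x - f (flipL i x)) / 2).

Definition energy (m : nat) (f : list bool -> R) : R :=
  sumL (fun i => infl m f i ^ 2) (seq 0 m).

(** Multiplying [chi S] by [x_i] toggles the membership of [i] in [S]. When [c] lives on sets
    avoiding [i], [flipL i S] is [S] with [i] added. *)
Lemma avg_mul_walsh m f c i : (i < m)%nat ->
  avg m (fun x => f x * (pm (nth i x false) * walsh m c x)) =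
  tot m (fun S => c S * hat m f (flipL i S)).
Proof.
  intros Hi. unfold avg, walsh, tot, hat.
  rewrite (sumW_ext _ _ _ _ (fun x => sumW [true; false] (fun _ => 1) m
    (fun S => c S * (f x * chi (flipL i S) x)))).
  - rewrite sumW_swap. apply sumW_ext. intros S _. now rewrite sumW_scal.
  - intros x Hx. rewrite <- Rmult_assoc, <- sumW_scal. apply sumW_ext. intros S HS.
    rewrite chi_flipL_set by lia. ring.
Qed.

(** Average each point with its flip at [i]: since [x_i u] is odd in that coordinate, only the
    difference of [f] across the edge survives. *)
Lemma avg_sign_infl m f u i b :
  (i < m)%nat -> 0 <= b ->
  (forall x, length x = m -> u (flipL i x) = u x) ->
  (forall x, length x = m -> Rabs (u x) <= b) ->
  avg m (fun x => f x * (pm (nth i x false) * u x)) <= b * infl m f i.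
Proof.
  intros Hi Hb Hu Hub.
  set (F := fun x => f x * (pm (nth i x false) * u x)).
  replace (avg m F) with (avg m (fun x => / 2 * (F x + F (flipL i x)))).
  - unfold infl, avg. rewrite <- sumW_scal. apply avg_le. intros x Hx.
    unfold F. rewrite nth_flipL, Hu by lia.
    set (D := f x - f (flipL i x)).
    assert (H : / 2 * (f x * (pm (nth i x false) * u x) +
      f (flipL i x) * (pm (negb (nth i x false)) * u x)) =
      D * / 2 * pm (nth i x false) * u x).
    { unfold D. destruct (nth i x false); simpl; field. }
    rewrite H. eapply Rle_trans; [apply Rle_abs|].
    rewrite !Rabs_mult.
    replace (Rabs (pm (nth i x false))) with 1
      by (destruct (nth i x false); simpl; [rewrite Rabs_R1|rewrite Rabs_left]; lra).
    rewrite (Rabs_pos_eq (/ 2)) by lra. specialize (Hub x Hx).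
    pose proof (Rabs_pos D). pose proof (Rabs_pos (u x)).
    replace (Rabs D * / 2 * 1 * Rabs (u x)) with (Rabs (u x) * (Rabs D / 2)) by field.
    apply Rmult_le_compat_r; lra.
  - unfold avg at 1. rewrite sumW_scal, sumW_add. fold (avg m F).
    fold (avg m (fun x => F (flipL i x))). rewrite avg_flipL. field.
Qed.

(** Expand the square. For distinct [i] and [j] a flip at [i] changes only the sign [x_i], because
    both [v i] and [v j] ignore the coordinates in [L]; so cross terms have mean zero. *)
Lemma avg_sq_sum_signs_le m (v : nat -> list bool -> R) L :
  NoDup L -> (forall i, In i L -> (i < m)%nat) ->
  (forall i j x, In i L -> In j L -> length x = m -> v i (flipL j x) = v i x) ->
  avg m (fun x => sumL (fun i => pm (nth i x false) * v i x) L ^ 2) <=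
  sumL (fun i => avg m (fun x => v i x ^ 2)) L.
Proof.
  intros HL Hm Hv.
  assert (E : avg m (fun x => sumL (fun i => pm (nth i x false) * v i x) L ^ 2) =
    sumL (fun i => sumL (fun j => avg m (fun x =>
      (pm (nth i x false) * v i x) * (pm (nth j x false) * v j x))) L) L).
  { unfold avg. rewrite (sumW_ext _ _ _ _ (fun x => sumL (fun i => sumL (fun j =>
      (pm (nth i x false) * v i x) * (pm (nth j x false) * v j x)) L) L)).
    - rewrite (sumW_sumL _ _ _ (fun i x => sumL (fun j =>
        (pm (nth i x false) * v i x) * (pm (nth j x false) * v j x)) L)).
      apply sumL_ext. intros i _.
      now rewrite (sumW_sumL _ _ _ (fun j x =>
        (pm (nth i x false) * v i x) * (pm (nth j x false) * v j x))).
    - intros x _. simpl. rewrite Rmult_1_r, <- sumL_scal. apply sumL_ext. intros i _.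
      rewrite Rmult_comm, <- sumL_scal. apply sumL_ext. intros; ring. }
  rewrite E. apply sumL_le. intros i Hi.
  assert (H0 : 0 <= avg m (fun x => v i x ^ 2))
    by (apply sumW_ge0; [auto|]; intros; apply pow2_ge_0).
  apply Rle_trans with (sumL (fun j => if excluded_middle_informative (j = i)
    then (fun j => avg m (fun x => v j x ^ 2)) j else 0) L).
  - apply sumL_le. intros j Hj. destruct (excluded_middle_informative (j = i)) as [->|n].
    + apply Req_le, sumW_ext. intros x _.
      replace (pm (nth i x false) * v i x * (pm (nth i x false) * v i x)) with
        (pm (nth i x false) * pm (nth i x false) * v i x ^ 2) by ring.
      rewrite pm_sq. ring.
    + apply Req_le, (avg_odd m i). intros x Hx.
      pose proof (Hm i Hi). rewrite nth_flipL, (nth_flipL_neq j i), !Hv by (auto; lia).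
      destruct (nth i x false); simpl; ring.
  - now apply (sumL_single_le L i (fun j => avg m (fun x => v j x ^ 2))).
Qed.

(* Each [f_i], the part of the derivative of [f] at [i] supported off [T], is cut at height
   [sqrt (tau E f_i^2)]: the bounded part is paired with the influence of [i], and the tails,
   multiplied by the signs [x_i], form an orthogonal family whose size is controlled
   by the fourth moments. *)
Lemma level_weight_cut m f T k tau :
  length T = m -> 0 < tau -> (forall x, length x = m -> Rabs (f x) <= 1) ->
  tot m (fun S => if ((cnt S =? Datatypes.S k)%nat && (cap S T =? 1)%nat)%bool
                  then hat m f S ^ 2 else 0)
    <= 2 * (tau * energy m f + 9 ^ k / tau).
Proof.
  intros HT Htau Hf.
  (* Coefficients of [f_i], indexed by the sets of size [k] left after removing [i]. They are
     disjoint from [T], so for [i] in [T] the flip puts [i] back. *)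
  set (c := fun i S => if ((cnt S =? k)%nat && (cap S T =? 0)%nat)%bool
                       then hat m f (flipL i S) else 0).
  set (L := filter (fun i => nth i T false) (seq 0 m)).
  assert (HL : forall i, In i L <-> (i < m)%nat /\ nth i T false = true).
  { intros i. unfold L. rewrite filter_In, in_seq. split; intros; split; try easy; lia. }
  assert (HLd : NoDup L) by (apply NoDup_filter, seq_NoDup).
  set (a := fun i => tot m (fun S => c i S ^ 2)).
  set (g := fun i => walsh m (c i)).
  assert (Ha0 : forall i, 0 <= a i)
    by (intros; apply sumW_ge0; [auto|]; intros; apply pow2_ge_0).
  (* Every [S] counted on the left appears on the right for the unique [i] in its intersection with
     [T]. *)
  apply Rle_trans with (sumL a L).
  { unfold a. rewrite (sumL_ext _ (fun i => tot m (fun S => c i (flipL i S) ^ 2)))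
      by (intros i _; now rewrite (tot_flipL m i (fun S => c i S ^ 2))).
    unfold tot. rewrite <- (sumW_sumL _ _ _ (fun i S => c i (flipL i S) ^ 2)).
    apply tot_le. intros S HS.
    assert (H0 : 0 <= sumL (fun i => c i (flipL i S) ^ 2) L)
      by (apply sumL_ge0; intros; apply pow2_ge_0).
    destruct (Nat.eqb_spec (cnt S) (Datatypes.S k)) as [H1|H1]; [|easy].
    destruct (Nat.eqb_spec (cap S T) 1) as [H2|H2]; simpl; [|easy].
    destruct (cap_1_flipL S T) as [i [I1 [I2 [I3 I4]]]]; [lia|easy|].
    apply Rle_trans with (c i (flipL i S) ^ 2).
    - unfold c. rewrite I3, flipL_involutive.
      replace (cnt (flipL i S)) with k by lia. rewrite Nat.eqb_refl. simpl. lra.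
    - apply (sumL_term (fun i => c i (flipL i S) ^ 2)).
      + intros; apply pow2_ge_0.
      + apply HL. rewrite <- HT. auto. }
  assert (Hg2 : forall i, avg m (fun x => g i x ^ 2) = a i) by (intros; apply walsh_norm).
  assert (Hg4 : forall i, avg m (fun x => g i x ^ 4) <= 9 ^ k * a i ^ 2).
  { intros i. rewrite <- Hg2. apply walsh_fourth_moment. intros S _ HS.
    unfold c. destruct (Nat.eqb_spec (cnt S) k); [lia|easy]. }
  assert (Hginv : forall i j x, In j L -> length x = m -> g i (flipL j x) = g i x).
  { intros i j x Hj Hx. apply sumW_ext. intros S HS. apply HL in Hj. unfold c.
    destruct (Nat.eqb_spec (cap S T) 0) as [H|H]; [|rewrite Bool.andb_false_r; ring].
    rewrite chi_flipL_point; [easy|]. apply cap_0_nth with T; [lia|easy|easy]. }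
  assert (Hfg : forall i, In i L ->
    avg m (fun x => f x * (pm (nth i x false) * g i x)) = a i).
  { intros i Hi. unfold g. rewrite avg_mul_walsh by (now apply HL).
    apply sumW_ext. intros S _. unfold c. destruct (_ && _)%bool; ring. }
  set (v := fun i x => if Rle_dec (g i x ^ 2) (tau * a i) then 0 else g i x).
  assert (Hvinv : forall i j x, In j L -> length x = m -> v i (flipL j x) = v i x).
  { intros i j x Hj Hx. unfold v. now rewrite Hginv. }
  set (V := fun x => sumL (fun i => pm (nth i x false) * v i x) L).
  assert (Hk : 0 < 9 ^ k) by (apply pow_lt; lra).
  (* Markov at the fourth moment: where [v] is nonzero, [g^2 > tau * a], so [tau * a * v^2 <= g^4].
     Dividing by [a] needs [a] nonzero; otherwise [v^2 <= g^2] already has mean 0. *)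
  assert (Hv2 : forall i, avg m (fun x => v i x ^ 2) <= 9 ^ k / tau * a i).
  { intros i. destruct (Req_dec (a i) 0) as [E|E].
    - rewrite E, Rmult_0_r, <- E, <- Hg2. apply avg_le. intros x _. unfold v.
      destruct (Rle_dec _ _); [|lra]. pose proof (pow2_ge_0 (g i x)). simpl in *. lra.
    - assert (Ha : 0 < a i) by (specialize (Ha0 i); lra).
      apply Rmult_le_reg_l with (tau * a i); [now apply Rmult_lt_0_compat|].
      replace (tau * a i * (9 ^ k / tau * a i)) with (9 ^ k * a i ^ 2) by (field; lra).
      eapply Rle_trans; [|apply Hg4]. unfold avg. rewrite <- sumW_scal.
      apply avg_le. intros x _. unfold v. pose proof (pow4_ge0 (g i x)).
      destruct (Rle_dec _ _) as [H1|H1].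
      + replace (0 ^ 2) with 0 by ring. lra.
      + apply Rnot_le_lt in H1. pose proof (pow2_ge_0 (g i x)).
        replace (g i x ^ 4) with (g i x ^ 2 * g i x ^ 2) by ring.
        apply Rmult_le_compat_r; lra. }
  assert (HV2 : avg m (fun x => V x ^ 2) <= 9 ^ k / tau * sumL a L).
  { unfold V. eapply Rle_trans; [apply avg_sq_sum_signs_le; auto|].
    - intros i Hi. now apply HL.
    - rewrite <- sumL_scal. apply sumL_le. intros; apply Hv2. }
  assert (HfV : avg m (fun x => f x * V x) <= 9 ^ k / tau + / 4 * sumL a L).
  (* Young's inequality [f V <= lam f^2 / 2 + V^2 / (2 lam)]; this [lam] turns the bound on the mean
     of [V^2] into exactly a quarter of the total weight. *)
  { set (lam := 2 * 9 ^ k / tau).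
    assert (Hlam : 0 < lam) by (apply Rdiv_lt_0_compat; lra).
    apply Rle_trans with (avg m (fun x => lam / 2 + / (2 * lam) * V x ^ 2)).
    - apply avg_le. intros x Hx.
      assert (Hf2 : f x ^ 2 <= 1).
      { rewrite <- pow2_abs. specialize (Hf x Hx). pose proof (Rabs_pos (f x)). nra. }
      assert (H : 0 <= / (2 * lam) * (lam * f x - V x) ^ 2).
      { apply Rmult_le_pos; [|apply pow2_ge_0]. left. apply Rinv_0_lt_compat. lra. }
      replace (/ (2 * lam) * (lam * f x - V x) ^ 2) with
        (lam / 2 * f x ^ 2 - f x * V x + / (2 * lam) * V x ^ 2) in H by (field; lra).
      assert (lam / 2 * f x ^ 2 <= lam / 2 * 1) by (apply Rmult_le_compat_l; lra). lra.
    - unfold avg. rewrite sumW_add, sumW_scal, sumW_const by auto.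
      fold (avg m (fun x => V x ^ 2)).
      apply Rle_trans with (lam / 2 + / (2 * lam) * (9 ^ k / tau * sumL a L)).
      + apply Rplus_le_compat_l, Rmult_le_compat_l; [|easy].
        left. apply Rinv_0_lt_compat. lra.
      + unfold lam. apply Req_le. field. lra. }
  assert (Hu : forall i, In i L ->
    avg m (fun x => f x * (pm (nth i x false) * (g i x - v i x)))
      <= / 4 * a i + tau * infl m f i ^ 2).
  { intros i Hi. assert (Hsa : 0 <= sqrt tau * sqrt (a i)) by
      (apply Rmult_le_pos; apply sqrt_pos).
    apply Rle_trans with (sqrt tau * sqrt (a i) * infl m f i).
    - apply avg_sign_infl; [now apply HL|easy| |].
      + intros x Hx. now rewrite Hginv, Hvinv.
      + intros x Hx. unfold v. destruct (Rle_dec _ _) as [H|H].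
        * rewrite Rminus_0_r. rewrite <- sqrt_mult_alt by lra.
          rewrite <- (sqrt_Rsqr_abs (g i x)). apply sqrt_le_1_alt. unfold Rsqr. lra.
        * rewrite Rminus_diag, Rabs_R0. easy.
    - pose proof (pow2_ge_0 (sqrt (a i) / 2 - sqrt tau * infl m f i)) as H.
      replace ((sqrt (a i) / 2 - sqrt tau * infl m f i) ^ 2) with
        (/ 4 * (sqrt (a i) * sqrt (a i)) - sqrt tau * sqrt (a i) * infl m f i
         + (sqrt tau * sqrt tau) * infl m f i ^ 2) in H by field.
      rewrite !sqrt_sqrt in H by (auto; lra). lra. }
  (* The bounded parts and the tails each cost a quarter of the total weight. Absorbing both into
     the left side leaves one half, whence the factor 2 in the statement. *)
  assert (HA : sumL a L <= / 4 * sumL a L + tau * energy m f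
    + (9 ^ k / tau + / 4 * sumL a L)).
  { apply Rle_trans with (sumL (fun i =>
      avg m (fun x => f x * (pm (nth i x false) * (g i x - v i x)))) L
      + avg m (fun x => f x * V x)).
    - apply Req_le. unfold V.
      replace (avg m (fun x => f x * sumL (fun i => pm (nth i x false) * v i x) L)) with
        (sumL (fun i => avg m (fun x => f x * (pm (nth i x false) * v i x))) L).
      + rewrite <- sumL_add. apply sumL_ext. intros i Hi. rewrite <- (Hfg i Hi).
        unfold avg. rewrite <- sumW_add. apply sumW_ext. intros; ring.
      + unfold avg. rewrite <- (sumW_sumL _ _ _
          (fun i x => f x * (pm (nth i x false) * v i x))).
        apply sumW_ext. intros x _. now rewrite sumL_scal.
    - apply Rplus_le_compat; [|easy].
      apply Rle_trans with (sumL (fun i => / 4 * a i + tau * infl m f i ^ 2) L).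
      + apply sumL_le. easy.
      + rewrite sumL_add, !sumL_scal. apply Rplus_le_compat; [apply Rle_refl|].
        apply Rmult_le_compat_l; [lra|].
        apply sumL_incl; [intros; apply pow2_ge_0|easy|]. apply incl_filter. }
  lra.
Qed.

(** The second probability is really [cnt S * (1 / 2) ^ cnt S]; dropping the factor is harmless.
    Disjointness is carried along because, once the first element of [S] is put in [T], the rest
    must miss [T]. *)
Lemma avg_cap S : 
  avg (length S) (fun T => if (cap S T =? 0)%nat then 1 else 0) = (1 / 2) ^ cnt S /\
  ((1 <= cnt S)%nat ->
   (1 / 2) ^ cnt S <= avg (length S) (fun T => if (cap S T =? 1)%nat then 1 else 0)).
Proof.
  induction S as [|b S [IH1 IH2]]; simpl length.
  - split; [unfold avg; simpl; ring|]. simpl. lia.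
  - rewrite !avg_S. destruct b; simpl.
    + change (avg (length S) (fun s => 0)) with (sumW [true;false] qU (length S) (fun _ => 0)).
      rewrite sumW_zero, IH1. split; [lra|]. intros _.
      assert (0 <= avg (length S) (fun T => if (cap S T =? 1)%nat then 1 else 0)).
      { apply sumW_ge0; [auto|]. intros T _. destruct (cap S T =? 1)%nat; lra. }
      lra.
    + rewrite IH1. split; [lra|]. intros H. specialize (IH2 H). lra.
Qed.

(* Averaging over a uniformly random [T], which meets a given [S] exactly once
   with probability at least [2 ^ - |S|]. *)
Lemma level_weight m f k tau :
  0 < tau -> (forall x, length x = m -> Rabs (f x) <= 1) ->
  tot m (fun S => if (cnt S =? Datatypes.S k)%nat then hat m f S ^ 2 else 0)
    <= 2 ^ S k * (2 * (tau * energy m f + 9 ^ k / tau)).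
Proof.
  intros Htau Hf. set (b := 2 * (tau * energy m f + 9 ^ k / tau)).
  assert (H : avg m (fun T => tot m (fun S =>
    if ((cnt S =? Datatypes.S k)%nat && (cap S T =? 1)%nat)%bool then hat m f S ^ 2 else 0)) <= b).
  { rewrite <- (sumW_const [true; false] qU m b) by auto. apply avg_le.
    intros T HT. now apply level_weight_cut. }
  unfold avg, tot in H. rewrite sumW_swap in H.
  apply Rmult_le_reg_l with ((1 / 2) ^ S k); [apply pow_lt; lra|].
  rewrite <- Rmult_assoc, <- Rpow_mult_distr.
  replace (1 / 2 * 2) with 1 by field. rewrite pow1, Rmult_1_l.
  eapply Rle_trans; [|apply H]. unfold tot. rewrite <- sumW_scal. apply tot_le.
  intros S HS. destruct (Nat.eqb_spec (cnt S) (Datatypes.S k)) as [E|E]; simpl andb.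
  - destruct (avg_cap S) as [_ H2]. rewrite HS, E in H2. specialize (H2 ltac:(lia)).
    apply Rle_trans with (hat m f S ^ 2 *
      avg m (fun T => if (cap S T =? 1)%nat then 1 else 0)).
    + rewrite Rmult_comm. apply Rmult_le_compat_l; [apply pow2_ge_0|easy].
    + unfold avg. rewrite <- sumW_scal. apply Req_le, sumW_ext. intros T _.
      destruct (cap S T =? 1)%nat; ring.
  - simpl. rewrite sumW_zero. lra.
Qed.

(** Levels 1 to [D] are bounded one at a time after dropping [rho ^ cnt S <= 1]. The levels above
    [D] contribute at most [rho ^ D] times the total weight, which Parseval bounds by 1. *)
Lemma noise_weight_bound m f rho tau D :
  0 <= rho <= 1 -> 0 < tau -> (forall x, length x = m -> Rabs (f x) <= 1) ->
  tot m (fun S => if (cnt S =? 0)%nat then 0 else rho ^ cnt S * hat m f S ^ 2)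
    <= sumL (fun k => 2 ^ S k * (2 * (tau * energy m f + 9 ^ k / tau))) (seq 0 D)
       + rho ^ D.
Proof.
  intros Hrho Htau Hf.
  apply Rle_trans with (tot m (fun S =>
    sumL (fun k => if (cnt S =? Datatypes.S k)%nat then hat m f S ^ 2 else 0) (seq 0 D)
    + rho ^ D * hat m f S ^ 2)).
  - apply tot_le. intros S _. pose proof (pow2_ge_0 (hat m f S)) as H0.
    assert (H1 : 0 <= sumL (fun k => if (cnt S =? Datatypes.S k)%nat
      then hat m f S ^ 2 else 0) (seq 0 D)).
    { apply sumL_ge0. intros k _. destruct (cnt S =? Datatypes.S k)%nat; lra. }
    assert (H2 : forall n, 0 <= rho ^ n <= 1).
    { intros n. split; [apply pow_le; lra|]. rewrite <- (pow1 n). apply pow_incr. lra. }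
    destruct (cnt S) as [|d] eqn:E; simpl Nat.eqb in *.
    + assert (0 <= rho ^ D * hat m f S ^ 2) by (apply Rmult_le_pos; [apply H2|easy]). lra.
    + destruct (Nat.lt_ge_cases d D) as [Hd|Hd].
      * assert (H3 : hat m f S ^ 2 <= sumL (fun k => if (d =? k)%nat
          then hat m f S ^ 2 else 0) (seq 0 D)).
        { pose proof (sumL_term (fun k => if (d =? k)%nat then hat m f S ^ 2 else 0)
            (seq 0 D) d) as H3. simpl in H3. rewrite Nat.eqb_refl in H3. apply H3.
          - intros k. destruct (d =? k)%nat; simpl in *; lra.
          - apply in_seq. lia. }
        assert (H4 : rho ^ Datatypes.S d * hat m f S ^ 2 <= 1 * hat m f S ^ 2)
          by (apply Rmult_le_compat_r; [easy|apply H2]).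
        assert (0 <= rho ^ D * hat m f S ^ 2) by (apply Rmult_le_pos; [apply H2|easy]).
        lra.
      * assert (H3 : rho ^ Datatypes.S d <= rho ^ D).
        { replace (Datatypes.S d) with (D + (Datatypes.S d - D))%nat by lia.
          rewrite pow_add. rewrite <- (Rmult_1_r (rho ^ D)) at 2.
          apply Rmult_le_compat_l; apply H2. }
        assert (H4 : rho ^ Datatypes.S d * hat m f S ^ 2 <= rho ^ D * hat m f S ^ 2)
          by (apply Rmult_le_compat_r; easy).
        lra.
  - unfold tot. rewrite sumW_add, sumW_scal.
    rewrite (sumW_sumL _ _ _ (fun k S => if (cnt S =? Datatypes.S k)%nat
      then hat m f S ^ 2 else 0)).
    apply Rplus_le_compat.
    + apply sumL_le. intros k _. now apply level_weight.
    + rewrite <- (Rmult_1_r (rho ^ D)) at 2. apply Rmult_le_compat_l; [apply pow_le; lra|].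
      fold (tot m (fun S => hat m f S ^ 2)). rewrite <- parseval.
      rewrite <- (sumW_const [true; false] qU m 1) by auto. apply avg_le.
      intros x Hx. rewrite <- pow2_abs. specialize (Hf x Hx). pose proof (Rabs_pos (f x)). nra.
Qed.

(** * Noise correlation *)

Definition bits : alphabet bool.
Proof.
  refine (Alphabet bool [true; false] qU _ _ qU_ge0 qU_sum _).
  - repeat constructor; simpl; intuition congruence.
  - intros []; simpl; auto.
  - exists true. unfold qU. lra.
Defined.

Definition noise_letters : list (bool * bool * bool) :=
  list_prod (list_prod [true; false] [true; false]) [true; false].

Definition noise_bits (eps : R) (H : 0 <= eps <= 1) : alphabet (bool * bool * bool).
Proof.
  refine (Alphabet _ noise_letters (qN eps) _ _ _ _ _).
  - repeat constructor; simpl; intuition congruence.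
  - intros [[[] []] []]; simpl; tauto.
  - intros [[a b] []]; simpl; lra.
  - simpl. lra.
  - exists (true, true, true). simpl. lra.
Defined.

Definition old_bit (t : bool * bool * bool) : bool := let '(a, _, _) := t in a.
Definition new_bit (t : bool * bool * bool) : bool :=
  let '(a, b, u) := t in if u then b else a.

(** Walsh functions diagonalise the noise: in one coordinate the old and new signs have mean zero
    and correlation [1 - eps], and each coordinate of [S] contributes this factor. The auxiliary
    [T a b] fixes the first old and new bits. *)
Lemma noise_formula eps m F G :
  sumW noise_letters (qN eps) m (fun t => F (map old_bit t) * G (map new_bit t)) =
  tot m (fun S => (1 - eps) ^ cnt S * (hat m F S * hat m G S)).
Proof.
  revert F G. induction m as [|m IH]; intros F G.
  - unfold tot, hat, avg. simpl. ring.
  - set (T := fun a b => tot m (fun S => (1 - eps) ^ cnt S *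
      (hat m (fun x => F (a :: x)) S * hat m (fun x => G (b :: x)) S))).
    assert (IH' : forall a b, sumW noise_letters (qN eps) m
      (fun t => F (a :: map old_bit t) * G (b :: map new_bit t)) = T a b).
    { intros a b. apply (IH (fun x => F (a :: x)) (fun x => G (b :: x))). }
    rewrite tot_S.
    assert (E1 : tot m (fun s => (1 - eps) ^ cnt (true :: s) *
      (hat (S m) F (true :: s) * hat (S m) G (true :: s))) =
      (1 - eps) / 4 * (T true true - T true false - T false true + T false false)).
    { unfold T, tot. rewrite <- !sumW_sub, <- sumW_add, <- sumW_scal.
      apply sumW_ext. intros S _. rewrite !hat_cons. simpl. field. }
    assert (E0 : tot m (fun s => (1 - eps) ^ cnt (false :: s) *
      (hat (S m) F (false :: s) * hat (S m) G (false :: s))) =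
      1 / 4 * (T true true + T true false + T false true + T false false)).
    { unfold T, tot. rewrite <- !sumW_add, <- sumW_scal.
      apply sumW_ext. intros S _. rewrite !hat_cons. simpl. field. }
    rewrite E1, E0. unfold noise_letters at 1. simpl.
    change [(true, true, true); (true, true, false); (true, false, true);
      (true, false, false); (false, true, true); (false, true, false);
      (false, false, true); (false, false, false)] with noise_letters.
    rewrite !IH'. field.
Qed.

Lemma tot_cnt_0 m F :
  tot m (fun S => if (cnt S =? 0)%nat then F S else 0) = F (repeat false m).
Proof.
  revert F. induction m as [|m IH]; intros F; [easy|].
  rewrite tot_S. simpl. unfold tot at 1. rewrite sumW_zero, Rplus_0_l.
  apply (IH (fun s => F (false :: s))).
Qed.

Lemma chi_empty m x : chi (repeat false m) x = 1.
Proof.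
  revert x. induction m as [|m IH]; intros [|a x]; simpl; try easy.
  rewrite IH. ring.
Qed.

Lemma cnt_empty m : cnt (repeat false m) = O.
Proof. induction m; simpl; auto. Qed.

Lemma noise_formula_covariance eps m F :
  sumW noise_letters (qN eps) m (fun t => F (map old_bit t) * F (map new_bit t))
    - (avg m F) ^ 2 =
  tot m (fun S => if (cnt S =? 0)%nat then 0 else (1 - eps) ^ cnt S * hat m F S ^ 2).
Proof.
  rewrite noise_formula.
  assert (E : (avg m F) ^ 2 = tot m (fun S => if (cnt S =? 0)%nat
    then (1 - eps) ^ cnt S * hat m F S ^ 2 else 0)).
  { rewrite (tot_cnt_0 m (fun S => (1 - eps) ^ cnt S * hat m F S ^ 2)), cnt_empty.
    rewrite pow_O, Rmult_1_l. f_equal. apply sumW_ext. intros x _.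
    rewrite chi_empty. ring. }
  rewrite E. unfold tot. rewrite <- sumW_sub. apply sumW_ext. intros S _.
  destruct (cnt S =? 0)%nat; ring.
Qed.

(** * Stability of expectations and noise correlation *)

Lemma prob_le_add {X} (M : alphabet X) (A B D : (nat -> X) -> Prop) :
  (forall w, A w -> B w \/ D w) ->
  Prob (wt M) A <= Prob (wt M) B + Prob (wt M) D.
Proof.
  intros H. eapply Rle_trans; [|apply prob_union]. now apply prob_mono.
Qed.

Lemma exp_diff {X} (M : alphabet X) (F G : (nat -> X) -> bool) d :
  Prob (wt M) (fun w => F w <> G w) <= d ->
  Rabs (ExpPM (wt M) F - ExpPM (wt M) G) <= 2 * d.
Proof.
  intros Hd. unfold ExpPM.
  assert (H : forall b, Prob (wt M) (fun w => F w = b) <=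
    Prob (wt M) (fun w => G w = b) + d).
  { intros b. eapply Rle_trans; [|apply Rplus_le_compat_l, Hd].
    apply prob_le_add. intros w Hw. destruct (Bool.bool_dec (G w) b); [auto|].
    right. congruence. }
  assert (H' : forall b, Prob (wt M) (fun w => G w = b) <=
    Prob (wt M) (fun w => F w = b) + d).
  { intros b. eapply Rle_trans; [|apply Rplus_le_compat_l, Hd].
    apply prob_le_add. intros w Hw. destruct (Bool.bool_dec (F w) b); [auto|].
    right. congruence. }
  pose proof (H true). pose proof (H false). pose proof (H' true). pose proof (H' false).
  apply Rabs_le. lra.
Qed.

Lemma exp_bound {X} (M : alphabet X) (F : (nat -> X) -> bool) :
  Rabs (ExpPM (wt M) F) <= 1.
Proof.
  unfold ExpPM. pose proof (prob_full M) as H.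
  assert (H' : forall b, 0 <= Prob (wt M) (fun w => F w = b) <= 1).
  { intros b. split; [apply prob_ge0|]. rewrite <- H. now apply prob_mono. }
  pose proof (H' true). pose proof (H' false). apply Rabs_le. lra.
Qed.

Lemma exp_depends {X} (M : alphabet X) x0 m (F : (nat -> X) -> bool) :
  depends m F ->
  ExpPM (wt M) F = sumW (letters M) (wt M) m (fun s => pm (F (extend x0 s))).
Proof.
  intros HF. unfold ExpPM.
  rewrite (prob_ext M (fun w => F w = false) (fun w => negb (F w) = true))
    by (intros w; destruct (F w); simpl; easy).
  rewrite (prob_depends M x0 m F HF), (prob_depends M x0 m (fun w => negb (F w))).
  - rewrite <- !sumW_scal, <- sumW_add. apply sumW_ext. intros s _.
    destruct (F (extend x0 s)); simpl; ring.
  - intros w w' E. now rewrite (HF w w').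
Qed.

Lemma take_map {X Y} (h : X -> Y) m w : take m (fun i => h (w i)) = map h (take m w).
Proof.
  revert w. induction m as [|m IH]; intros w; simpl; [easy|].
  now rewrite (IH (fun i => w (S i))).
Qed.

Lemma extend_map {X Y} (h : X -> Y) x0 s :
  (fun i => h (extend x0 s i)) = extend (h x0) (map h s).
Proof.
  apply functional_extensionality. intros i. unfold extend. now rewrite map_nth.
Qed.

Lemma pm_pmul a b : pm (pmul a b) = pm a * pm b.
Proof. destruct a, b; simpl; ring. Qed.

Lemma noise_corr_depends eps (Heps : 0 <= eps <= 1) m g :
  depends m g ->
  NoiseCorr eps g = sumW noise_letters (qN eps) m (fun t =>
    pm (g (extend false (map old_bit t))) * pm (g (extend false (map new_bit t)))).
Proof.
  intros Hg. unfold NoiseCorr.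
  rewrite (exp_depends (noise_bits eps Heps) (false, false, false) m).
  - apply sumW_ext. intros t _. rewrite pm_pmul.
    change (omOf (extend (false, false, false) t)) with
      (fun i => old_bit (extend (false, false, false) t i)).
    change (omEps (extend (false, false, false) t)) with
      (fun i => new_bit (extend (false, false, false) t i)).
    now rewrite !extend_map.
  - intros t t' E. f_equal; apply Hg.
    + change (take m (fun i => old_bit (t i)) = take m (fun i => old_bit (t' i))).
      now rewrite (take_map old_bit m t), (take_map old_bit m t'), E.
    + change (take m (fun i => new_bit (t i)) = take m (fun i => new_bit (t' i))).
      now rewrite (take_map new_bit m t), (take_map new_bit m t'), E.
Qed.

(** Both the original and the noisy sequence are uniform, so the product changes with probability at
    most [2 d]; passing to values 1 and -1 doubles this. *)
Lemma noise_corr_diff eps (Heps : 0 <= eps <= 1) f g d :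
  Prob qU (fun w => f w <> g w) <= d ->
  Rabs (NoiseCorr eps f - NoiseCorr eps g) <= 4 * d.
Proof.
  intros Hd. replace (4 * d) with (2 * (d + d)) by ring.
  apply (exp_diff (noise_bits eps Heps)).
  assert (Hp : forall h : bool * bool * bool -> bool,
    (forall b, sumL (fun x => if excluded_middle_informative (h x = b)
      then qN eps x else 0) noise_letters <= / 2) ->
    Prob (qN eps) (fun t => f (fun i => h (t i)) <> g (fun i => h (t i))) <= d).
  { intros h Hh. eapply Rle_trans; [|apply Hd].
    apply (prob_push (noise_bits eps Heps) bits (fun _ => h) (fun w => f w <> g w)).
    intros _ b. apply Hh. }
  assert (H1 := Hp old_bit). assert (H2 := Hp new_bit).
  eapply Rle_trans; [|apply Rplus_le_compat; [apply H1|apply H2]].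
  - apply (prob_le_add (noise_bits eps Heps)). intros t Ht.
    change (fun i => old_bit (t i)) with (omOf t).
    change (fun i => new_bit (t i)) with (omEps t).
    destruct (Bool.bool_dec (f (omOf t)) (g (omOf t))); [|auto].
    destruct (Bool.bool_dec (f (omEps t)) (g (omEps t))); [congruence|auto].
  - intros []; simpl; repeat destruct excluded_middle_informative; try easy; lra.
  - intros []; simpl; repeat destruct excluded_middle_informative; try easy; lra.
Qed.

(** * Reduction to functions on a finite cube *)

Lemma bool_approximation f d : measurableBF f -> 0 < d ->
  exists m g, depends m g /\ Prob qU (fun w => f w <> g w) <= d.
Proof.
  intros Hf Hd. destruct (meas_approximable bits _ Hf d Hd) as [m [g [H1 H2]]].
  exists m, g. split; [easy|]. eapply Rle_trans; [|apply H2].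
  apply (prob_mono bits). intros w Hw Hn. apply Hw.
  destruct (f w), (g w); try easy; exfalso; intuition congruence.
Qed.

Lemma prob_flip k (A : (nat -> bool) -> Prop) :
  Prob qU (fun w => A (flip k w)) <= Prob qU A.
Proof.
  apply (prob_push bits bits (fun i b => if Nat.eqb i k then negb b else b) A).
  intros i b. simpl. unfold qU.
  destruct (Nat.eqb i k), b; simpl; repeat destruct excluded_middle_informative;
    try easy; lra.
Qed.

Lemma extend_flipL k s : (k < length s)%nat ->
  extend false (flipL k s) = flip k (extend false s).
Proof.
  intros Hk. apply functional_extensionality. intros i. unfold extend, flip.
  destruct (Nat.eqb_spec i k) as [->|H]; [now apply nth_flipL|now apply nth_flipL_neq].
Qed.

Lemma take_flip m k w w' : take m w = take m w' -> take m (flip k w) = take m (flip k w').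
Proof.
  intros E. revert k w w' E. induction m as [|m IH]; intros k w w' E; simpl; [easy|].
  injection E as E0 E1. unfold flip at 1 3. rewrite E0. f_equal.
  destruct k as [|k]; [exact E1|]. apply (IH k _ _ E1).
Qed.

Definition cube_sign (g : BoolFun) (s : list bool) : R := pm (g (extend false s)).

Lemma cube_sign_abs g s : Rabs (cube_sign g s) = 1.
Proof. unfold cube_sign. destruct (g _); simpl; [apply Rabs_R1|rewrite Rabs_left; lra]. Qed.

Lemma avg_sign_diff m g h : depends m g -> depends m h ->
  avg m (fun s => Rabs (cube_sign g s - cube_sign h s) / 2)
    = Prob qU (fun w => g w <> h w).
Proof.
  intros Hg Hh.
  change (Prob qU) with (Prob (X := bool) (wt bits)).
  rewrite (prob_ext bits (fun w => g w <> h w) (fun w => xorb (g w) (h w) = true))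
    by (intros w; destruct (g w), (h w); simpl; intuition congruence).
  rewrite (prob_depends bits false m (fun w => xorb (g w) (h w))).
  - apply sumW_ext. intros s _. unfold cube_sign.
    destruct (g (extend false s)), (h (extend false s)); simpl;
      try (rewrite Rminus_diag, Rabs_R0; lra); [rewrite Rabs_pos_eq|rewrite Rabs_left]; lra.
  - intros w w' E. now rewrite (Hg w w'), (Hh w w').
Qed.

Lemma infl_cube_le m f g d k :
  depends m g -> Prob qU (fun w => f w <> g w) <= d -> (k < m)%nat ->
  infl m (cube_sign g) k <= Infl f k + 2 * d.
Proof.
  intros Hg Hd Hk. unfold infl.
  apply Rle_trans with (avg m (fun s =>
    Rabs (cube_sign g s - cube_sign (fun w => g (flip k w)) s) / 2)).
  - apply Req_le, sumW_ext. intros s Hs. unfold cube_sign.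
    rewrite extend_flipL by lia. easy.
  - rewrite avg_sign_diff; [|easy|intros w w' E; now apply Hg, take_flip].
    apply Rle_trans with (Prob qU (fun w => f (flip k w) <> f w) +
      (Prob qU (fun w => f w <> g w) + Prob qU (fun w => f (flip k w) <> g (flip k w)))).
    + eapply Rle_trans; [|apply Rplus_le_compat_l, (prob_union bits)].
      apply (prob_le_add bits). intros w Hw.
      destruct (Bool.bool_dec (f w) (g w)); [|auto].
      destruct (Bool.bool_dec (f (flip k w)) (g (flip k w))); [|auto]. left. congruence.
    + pose proof (prob_flip k (fun w => f w <> g w)). unfold Infl. simpl in *. lra.
Qed.

Definition cond_avg (n : nat) (F : list bool -> R) (s : list bool) : R :=
  avg n (fun u => F (s ++ u)).

Lemma flipL_app k s u : (k < length s)%nat -> flipL k (s ++ u) = flipL k s ++ u.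
Proof.
  revert k. induction s as [|b s IH]; intros [|k] H; simpl in *; try lia; auto.
  rewrite IH; [easy|lia].
Qed.

Lemma avg_abs m F : Rabs (avg m F) <= avg m (fun s => Rabs (F s)).
Proof. apply sumW_abs. auto. Qed.

(** A flip at [k < m] commutes with averaging over the last [n] bits, so the triangle inequality can
    be applied under the average. *)
Lemma infl_cond_avg_le m n F k : (k < m)%nat ->
  infl m (cond_avg n F) k <= infl (m + n) F k.
Proof.
  intros Hk. unfold infl, avg at 2. rewrite sumW_app. apply avg_le. intros s Hs.
  unfold cond_avg. unfold avg at 1 2. rewrite <- sumW_sub.
  fold (avg n (fun u => F (s ++ u) - F (flipL k s ++ u))).
  unfold Rdiv. rewrite Rmult_comm.
  eapply Rle_trans; [apply Rmult_le_compat_l; [lra|apply avg_abs]|].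
  unfold avg. rewrite <- sumW_scal. apply Req_le, sumW_ext. intros u _.
  rewrite flipL_app by lia. ring.
Qed.

Lemma cond_avg_abs n F s : (forall x, Rabs (F x) <= 1) -> Rabs (cond_avg n F s) <= 1.
Proof.
  intros HF. eapply Rle_trans; [apply avg_abs|].
  rewrite <- (sumW_const [true; false] qU n 1) by auto. apply avg_le. auto.
Qed.

(** Since [g] ignores the last [n] bits, the difference is the conditional mean of [g - h]. It is
    bounded by 2, so its square is at most twice its absolute value; the other factor 2 is the gap
    between 1 and -1. *)
Lemma cond_avg_dist m n g h :
  depends m g -> depends (m + n) h ->
  avg m (fun s => (cube_sign g s - cond_avg n (cube_sign h) s) ^ 2)
    <= 4 * Prob qU (fun w => g w <> h w).
Proof.
  intros Hg Hh.
  rewrite <- (avg_sign_diff (m + n) g h); [|apply depends_mono with m; [lia|easy]|easy].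
  unfold avg at 2. rewrite sumW_app, <- sumW_scal. apply avg_le. intros s Hs.
  set (z := cube_sign g s - cond_avg n (cube_sign h) s).
  assert (Hz : Rabs z <= 2).
  { unfold z. eapply Rle_trans; [apply Rabs_triang|]. rewrite Rabs_Ropp, cube_sign_abs.
    pose proof (cond_avg_abs n (cube_sign h) s
      (fun x => Req_le _ _ (cube_sign_abs h x))). lra. }
  apply Rle_trans with (2 * Rabs z).
  - rewrite <- pow2_abs. pose proof (Rabs_pos z). nra.
  - assert (H : Rabs z <= avg n (fun u => Rabs (cube_sign g (s ++ u) - cube_sign h (s ++ u)))).
    { eapply Rle_trans; [|apply avg_abs]. apply Req_le. f_equal. unfold z, cond_avg, avg.
      rewrite sumW_sub. f_equal.
      rewrite <- (sumW_const [true; false] qU n (cube_sign g s)) by auto.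
      apply sumW_ext. intros u Hu. unfold cube_sign. f_equal. apply Hg.
      rewrite <- (firstn_take m (length (s ++ u)) (extend false (s ++ u)))
        by (rewrite length_app; lia).
      rewrite take_extend, <- Hs, take_extend, firstn_app, Nat.sub_diag, firstn_O.
      now rewrite firstn_all, app_nil_r. }
    unfold Rdiv. replace 4 with (2 * 2) by ring.
    rewrite (sumW_ext _ _ _ _ (fun u => / 2 *
      Rabs (cube_sign g (s ++ u) - cube_sign h (s ++ u)))) by (intros; ring).
    rewrite sumW_scal. unfold avg in H. lra.
Qed.

(** Use [a^2 <= 2 b^2 + 2 (a - b)^2] on each coefficient, then Parseval for [F - G]. *)
Lemma noise_weight_perturb m F G rho : 0 <= rho <= 1 ->
  tot m (fun S => if (cnt S =? 0)%nat then 0 else rho ^ cnt S * hat m F S ^ 2) <=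
  2 * tot m (fun S => if (cnt S =? 0)%nat then 0 else rho ^ cnt S * hat m G S ^ 2) +
  2 * avg m (fun x => (F x - G x) ^ 2).
Proof.
  intros Hrho. rewrite parseval. unfold tot. rewrite <- !sumW_scal, <- sumW_add.
  apply tot_le. intros S _.
  assert (E : hat m (fun x => F x - G x) S = hat m F S - hat m G S).
  { unfold hat, avg. rewrite <- sumW_sub. apply sumW_ext. intros; ring. }
  rewrite E. set (a := hat m F S). set (b := hat m G S).
  pose proof (pow2_ge_0 (a - b)). destruct (cnt S =? 0)%nat; [lra|].
  assert (Hr : 0 <= rho ^ cnt S <= 1).
  { split; [apply pow_le; lra|]. rewrite <- (pow1 (cnt S)). apply pow_incr. lra. }
  set (r := rho ^ cnt S) in *.
  assert (H1 : r * a ^ 2 <= r * (2 * b ^ 2 + 2 * (a - b) ^ 2)).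
  { apply Rmult_le_compat_l; [lra|]. pose proof (pow2_ge_0 (a - 2 * b)). nra. }
  assert (H2 : r * (2 * (a - b) ^ 2) <= 1 * (2 * (a - b) ^ 2))
    by (apply Rmult_le_compat_r; lra).
  lra.
Qed.

Lemma Hsum_partial f h m : Hsum f h -> sumL (fun k => Infl f k ^ 2) (seq 0 m) <= h.
Proof.
  intros H. apply Rle_trans with (sumL (fun k => Infl f k ^ 2) (seq 0 (S m))).
  - apply sumL_seq_mono; [intros; apply pow2_ge_0|lia].
  - rewrite sumL_seq_sum_f_R0. apply sum_incr; [exact H|]. intros; apply pow2_ge_0.
Qed.

(* The conditional expectation given the first [m] bits does not increase influences, so its
   energy is controlled by [h] even though [m] is not bounded in terms of [h]. *)
Lemma energy_cond_avg_le m n f g d h : Hsum f h ->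
  depends (m + n) g -> Prob qU (fun w => f w <> g w) <= d ->
  energy m (cond_avg n (cube_sign g)) <= 2 * h + INR m * (8 * d ^ 2).
Proof.
  intros Hh Hg Hd. unfold energy.
  apply Rle_trans with (sumL (fun k => 2 * Infl f k ^ 2 + 8 * d ^ 2) (seq 0 m)).
  - apply sumL_le. intros k Hk. apply in_seq in Hk.
    assert (H : infl m (cond_avg n (cube_sign g)) k <= Infl f k + 2 * d).
    { eapply Rle_trans; [apply infl_cond_avg_le; lia|]. apply infl_cube_le; auto; lia. }
    assert (H0 : 0 <= infl m (cond_avg n (cube_sign g)) k).
    { apply sumW_ge0; [auto|]. intros s _.
      pose proof (Rabs_pos (cond_avg n (cube_sign g) s -
        cond_avg n (cube_sign g) (flipL k s))). lra. }
    apply Rle_trans with ((Infl f k + 2 * d) ^ 2); [now apply pow_incr|].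
    pose proof (pow2_ge_0 (Infl f k - 2 * d)). nra.
  - rewrite sumL_add, sumL_scal. apply Rplus_le_compat.
    + apply Rmult_le_compat_l; [lra|]. now apply Hsum_partial.
    + clear. induction m as [|m IH]; [simpl; lra|].
      rewrite sumL_seq_S, S_INR. lra.
Qed.

(** * Choice of parameters and conclusion *)

(** The order of choice matters: [tau] is taken large enough to tame the terms [9 ^ k / tau], and
    only then is the energy threshold chosen, depending on [tau]. Adding 1 to [K1] and [K2] keeps
    the quotients positive when [D] is 0. *)
Lemma level_sum_le D e1 : 0 < e1 -> exists tau, 0 < tau /\ exists e, 0 < e /\
  forall y, y <= e ->
  sumL (fun k => 2 ^ S k * (2 * (tau * y + 9 ^ k / tau))) (seq 0 D) <= 2 * e1.
Proof.
  intros He1. set (K1 := sumL (fun k => 2 ^ S k * 2) (seq 0 D)).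
  set (K2 := sumL (fun k => 2 ^ S k * 2 * 9 ^ k) (seq 0 D)).
  assert (H1 : 0 <= K1).
  { apply sumL_ge0. intros k _. apply Rmult_le_pos; [apply pow_le|]; lra. }
  assert (H2 : 0 <= K2).
  { apply sumL_ge0. intros k _. repeat apply Rmult_le_pos; try apply pow_le; lra. }
  set (tau := (K2 + 1) / e1). assert (Htau : 0 < tau) by (apply Rdiv_lt_0_compat; lra).
  exists tau. split; [easy|]. exists (e1 / ((K1 + 1) * tau)). split.
  { apply Rdiv_lt_0_compat; [easy|]. apply Rmult_lt_0_compat; lra. }
  intros y Hy.
  rewrite (sumL_ext _ (fun k => tau * y * (2 ^ S k * 2) + / tau * (2 ^ S k * 2 * 9 ^ k)))
    by (intros; field; lra).
  rewrite sumL_add, !sumL_scal. fold K1 K2.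
  assert (tau * y * K1 <= e1).
  { apply Rle_trans with (tau * (e1 / ((K1 + 1) * tau)) * K1).
    - apply Rmult_le_compat_r; [easy|]. apply Rmult_le_compat_l; lra.
    - replace (tau * (e1 / ((K1 + 1) * tau)) * K1) with (e1 * (K1 / (K1 + 1)))
        by (field; lra).
      rewrite <- (Rmult_1_r e1) at 2. apply Rmult_le_compat_l; [lra|].
      apply Rmult_le_reg_r with (K1 + 1); [lra|]. unfold Rdiv.
      rewrite Rmult_assoc, Rinv_l; lra. }
  assert (/ tau * K2 <= e1).
  { unfold tau. replace (/ ((K2 + 1) / e1) * K2) with (e1 * (K2 / (K2 + 1))) by (field; lra).
    rewrite <- (Rmult_1_r e1) at 2. apply Rmult_le_compat_l; [lra|].
    apply Rmult_le_reg_r with (K2 + 1); [lra|]. unfold Rdiv.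
    rewrite Rmult_assoc, Rinv_l; lra. }
  lra.
Qed.

Lemma covariance_small eps eta : 0 < eps <= 1 -> 0 < eta ->
  exists e, 0 < e /\ forall f h, measurableBF f -> Hsum f h -> h < e ->
  Rabs (NoiseCorr eps f - (ExpPM qU f) ^ 2) < eta.
Proof.
  (* The final error is at most [30 e1]: [4 e1] from the noise correlations, [4 e1] from the squared
     means, and [2 * 3 e1 + 2 * 8 e1] from the spectral weight. *)
  intros Heps Heta. set (e1 := eta / 40). assert (He1 : 0 < e1) by (unfold e1; lra).
  assert (Heps' : 0 <= eps <= 1) by lra.
  destruct (pow_lt_1_zero (1 - eps)) with (y := e1) as [D HD];
    [rewrite Rabs_pos_eq; lra|easy|].
  specialize (HD D (le_n D)). rewrite Rabs_pos_eq in HD by (apply pow_le; lra).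
  destruct (level_sum_le D e1 He1) as [tau [Htau [e [He HS]]]].
  exists (e / 4). split; [lra|]. intros f h Hf Hh Hhe.
  destruct (bool_approximation f e1 Hf He1) as [m [g [Hg1 Hg2]]].
  (* Now that [m] is fixed, [d] is chosen so that the [m] influence errors add at most [e / 2] to
     the energy; the bound [d <= 1] gives [d^2 <= d]. The remaining [e / 2] comes from [2 h] with
     [h < e / 4]. *)
  set (d := Rmin (Rmin 1 e1) (e / (16 * (INR m + 1)))).
  pose proof (pos_INR m) as Hm.
  assert (Hd0 : 0 < e / (16 * (INR m + 1))) by (apply Rdiv_lt_0_compat; lra).
  assert (Hd : 0 < d) by (repeat apply Rmin_glb_lt; lra).
  assert (Hd1 : d <= 1) by (eapply Rle_trans; [apply Rmin_l|apply Rmin_l]).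
  assert (Hde : d <= e1) by (eapply Rle_trans; [apply Rmin_l|apply Rmin_r]).
  assert (Hdm : INR m * (8 * d ^ 2) <= e / 2).
  { apply Rle_trans with ((INR m + 1) * (8 * (e / (16 * (INR m + 1))))).
    - apply Rmult_le_compat; [easy| |lra|].
      + apply Rmult_le_pos; [lra|apply pow2_ge_0].
      + apply Rmult_le_compat_l; [lra|]. apply Rle_trans with d; [nra|apply Rmin_r].
    - apply Req_le. field. lra. }
  destruct (bool_approximation f d Hf Hd) as [n [g' [Hg1' Hg2']]].
  assert (Hg3 : depends (m + n) g') by (apply depends_mono with n; [lia|easy]).
  set (G := cube_sign g). set (H := cond_avg n (cube_sign g')).
  assert (HE : energy m H <= e).
  { eapply Rle_trans; [apply (energy_cond_avg_le m n f g' d h); auto|]. lra. }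
  pose proof (noise_weight_bound m H (1 - eps) tau D ltac:(lra) Htau
    (fun x _ => cond_avg_abs n _ x (fun y => Req_le _ _ (cube_sign_abs g' y)))) as HW.
  specialize (HS _ HE).
  assert (Hdist : avg m (fun s => (G s - H s) ^ 2) <= 8 * e1).
  { eapply Rle_trans; [apply cond_avg_dist; easy|].
    assert (Prob qU (fun w => g w <> g' w) <=
      Prob qU (fun w => f w <> g w) + Prob qU (fun w => f w <> g' w)).
    { apply (prob_le_add bits). intros w Hw.
      destruct (Bool.bool_dec (f w) (g w)); [right; congruence|auto]. }
    lra. }
  pose proof (noise_weight_perturb m G H (1 - eps) ltac:(lra)) as HP.
  assert (HG : NoiseCorr eps g - (ExpPM qU g) ^ 2 =
    tot m (fun S => if (cnt S =? 0)%nat then 0 else (1 - eps) ^ cnt S * hat m G S ^ 2)).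
  { rewrite <- noise_formula_covariance, (noise_corr_depends eps Heps' m g Hg1).
    f_equal. f_equal. apply (exp_depends bits false m g Hg1). }
  assert (HG0 : 0 <= NoiseCorr eps g - (ExpPM qU g) ^ 2).
  { rewrite HG. apply sumW_ge0; [auto|]. intros S _. destruct (cnt S =? 0)%nat; [lra|].
    apply Rmult_le_pos; [apply pow_le; lra|apply pow2_ge_0]. }
  pose proof (noise_corr_diff eps Heps' f g e1 Hg2) as HN.
  pose proof (exp_diff bits f g e1 Hg2) as HX.
  pose proof (exp_bound bits f) as Xf. pose proof (exp_bound bits g) as Xg.
  change (wt bits) with qU in *.
  set (x := ExpPM qU f) in *. set (y := ExpPM qU g) in *.
  assert (HX2 : Rabs (y ^ 2 - x ^ 2) <= 4 * e1).
  { replace (y ^ 2 - x ^ 2) with ((x - y) * (- (x + y))) by ring.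
    rewrite Rabs_mult, Rabs_Ropp. pose proof (Rabs_triang x y).
    apply Rle_trans with (2 * e1 * 2); [|lra].
    apply Rmult_le_compat; try apply Rabs_pos; lra. }
  replace (NoiseCorr eps f - x ^ 2) with
    ((NoiseCorr eps f - NoiseCorr eps g) + (NoiseCorr eps g - y ^ 2) + (y ^ 2 - x ^ 2)) by ring.
  eapply Rle_lt_trans; [apply Rabs_triang|].
  eapply Rle_lt_trans; [apply Rplus_le_compat_r, Rabs_triang|].
  rewrite (Rabs_pos_eq (NoiseCorr eps g - y ^ 2)) by easy.
  rewrite HG in *. unfold e1 in *. lra.
Qed.

Theorem mainTheorem15 (fs : nat -> BoolFun)
  (hmeas : forall n, measurableBF (fs n))
  (hknow : forall n, exists p, 1 / 2 < p /\ knowable p (fs n))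
  (hH : forall e, 0 < e -> exists N, forall n, (n >= N)%nat ->
          exists h, Hsum (fs n) h /\ h < e) :
  noise_sensitive fs.
Proof.
  intros eps Heps eta Heta.
  destruct (covariance_small eps eta Heps Heta) as [e [He H]].
  destruct (hH e He) as [N HN]. exists N. intros n Hn.
  destruct (HN n Hn) as [h [H1 H2]].
  unfold Rdist. rewrite Rminus_0_r. now apply (H (fs n) h).
Qed.
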